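(* Let $(A,L)$ be a Lie--Rinehart algebra with a divergence operator $\operatorname{div}$, together with an element $\Pi\in\Lambda_A^2L$ satisfying $[\Pi,\Pi]=0$. If $\Pi$ is unimodular, then $H^\bullet(\Lambda_A^\bullet L,\partial_\Pi)$ is a BV algebra. In particular, the Poisson cohomology $H^\bullet_{\mathrm{Poiss}}(M)$ of a Poisson manifold $M$ is a BV algebra when the Poisson structure is unimodular.
   Context: A Lie--Rinehart algebra $(A,L)$ consists of a commutative algebra $A$ (over a field), a Lie algebra $L$ that is also an $A$-module, and a Lie algebra map (the anchor) $L\to\operatorname{Der}(A)$, written $X\mapsto(a\mapsto X(a))$, such that $[X,fY]=f[X,Y]+X(f)Y$ for $f\in A$, $X,Y\in L$. The exterior algebra $\Lambda_A^\bullet L$ is a Gerstenhaber algebra: it is graded-commutative and carries the unique bracket that is a super Lie bracket on the shift by one, satisfies $[a,bc]=[a,b]c+(-1)^{(|a|-1)|b|}b[a,c]$, restricts to the bracket of $L$, and satisfies $[X,f]=X(f)$ for $X\in L$, $f\in A$. A divergence operator is an additive map $\operatorname{div}:L\to A$ with $\operatorname{div}[X,Y]=X(\operatorname{div}Y)-Y(\operatorname{div}X)$ and $\operatorname{div}(aX)=a\operatorname{div}X+X(a)$. The corresponding BV operator on $\Lambda_A^\bullet L$, which generates its Gerstenhaber bracket, is $$\Delta(X_1\wedge\cdots\wedge X_n)=\sum_{i<j}(-1)^{i+j}[X_i,X_j]\wedge X_1\wedge\cdots\widehat{X_i}\cdots\widehat{X_j}\cdots\wedge X_n+\sum_{i=1}^n(-1)^i\operatorname{div}(X_i)X_1\wedge\cdots\widehat{X_i}\cdots\wedge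 X_n.$$ A BV algebra is a graded, supercommutative associative algebra with an operator $\Delta$ of degree $-1$ such that $\Delta^2=0$ and $$\Delta(abc)-\Delta(ab)c+\Delta(a)bc-(-1)^{|a|}a\Delta(bc)-(-1)^{(|a|+1)|b|}b\Delta(ac)+(-1)^{|a|}a\Delta(b)c+(-1)^{|a|+|b|}ab\Delta(c)-\Delta(1)abc=0$$ for homogeneous $a,b,c$. It generates the Gerstenhaber bracket $[a,b]=(-1)^{|a|}\Delta(ab)-(-1)^{|a|}\Delta(a)b-a\Delta(b)+a\Delta(1)b$. The differential is $\partial_\Pi=[\Pi,-]$, which is a square-zero superderivation of both the product and the bracket, so that its cohomology is a Gerstenhaber algebra. The element $\Pi$ is called unimodular if the class of $\Delta(\Pi)$ in $H^1(\Lambda_A^\bullet L,\partial_\Pi)$ is zero, i.e. if there exists $a\in A$ such that $\Delta(\Pi)=[\Pi,a]$. For a Poisson manifold $M$ with Poisson bivector $\Pi$, one takes $A=C^\infty(M)$, $L=\mathfrak X(M)$ (vector fields, with identity anchor) and a divergence operator on $\mathfrak X(M)$; $H^\bullet_{\mathrm{Poiss}}(M)$ is the cohomology of $(\Lambda^\bullet_{C^\infty(M)}\mathfrak X(M),[\Pi,-])$. The Poisson structure is unimodular if its modular class is trivial, i.e. if the derivation $f\mapsto\operatorname{div}(\{f,-\})$ is given by a Hamiltonian vector field. *)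

(* Defs.v *)
From HB Require Import structures.
From mathcomp Require Import all_boot all_order all_algebra.
From mathcomp Require Import all_classical all_reals all_analysis.
From mathcomp Require Import ring.

Set Implicit Arguments.
Unset Strict Implicit.
Unset Printing Implicit Defensive.

Import Order.TTheory GRing.Theory Num.Theory numFieldNormedType.Exports.
Local Open Scope ring_scope.
Local Open Scope quotient_scope.
Local Open Scope classical_set_scope.

Definition koszul (R : pzRingType) (n : int) : R := (-1) ^+ `|n|%N.

Lemma koszulD (R : pzRingType) (m n : int) :
  koszul R (m + n) = koszul R m * koszul R n.
Proof.
have E p : koszul R p = ((-1 : int) ^ p)%:~R.
  have -> : (-1 : int) ^ p = (-1) ^+ `|p|%N by case: p => // p; rewrite /exprz invr_sign.
  by rewrite rmorphXn /= rmorphN1.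
by rewrite !E -rmorphM /= exprzDr // unitrN1.
Qed.

(* The exterior algebra is the A-algebra generated by the elements of L, subject *)
(* to the A-linear relations of L and to X * X = 0.                            *)
Inductive eterm (A L : Type) :=
| EScal of A | EVec of L | EAdd of eterm A L & eterm A L | EMul of eterm A L & eterm A L.

HB.instance Definition _ (A L : Type) := gen_eqMixin (eterm A L).
HB.instance Definition _ (A L : Type) := gen_choiceMixin (eterm A L).

Inductive erel (A : comNzRingType) (L : lmodType A) : eterm A L -> eterm A L -> Prop :=
| ERefl s : erel s s
| ESym s t : erel s t -> erel t s
| ETrans s t u : erel s t -> erel t u -> erel s u
| EAddCongr s s' t t' : erel s s' -> erel t t' -> erel (EAdd s t) (EAdd s' t')
| EMulCongr s s' t t' : erel s s' -> erel t t' -> erel (EMul s t) (EMul s' t')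
| EAddA s t u : erel (EAdd s (EAdd t u)) (EAdd (EAdd s t) u)
| EAddC s t : erel (EAdd s t) (EAdd t s)
| EAdd0 s : erel (EAdd (EScal _ 0) s) s
| EAddN s : erel (EAdd (EMul (EScal _ (-1)) s) s) (EScal _ 0)
| EMulA s t u : erel (EMul s (EMul t u)) (EMul (EMul s t) u)
| EMul1 s : erel (EMul (EScal _ 1) s) s
| EMulDl s t u : erel (EMul (EAdd s t) u) (EAdd (EMul s u) (EMul t u))
| EMulDr s t u : erel (EMul s (EAdd t u)) (EAdd (EMul s t) (EMul s u))
| EScalC a s : erel (EMul s (EScal _ a)) (EMul (EScal _ a) s)
| EScalD a b : erel (EScal _ (a + b)) (EAdd (EScal _ a) (EScal _ b))
| EScalM a b : erel (EScal _ (a * b)) (EMul (EScal _ a) (EScal _ b))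
| EVecD X Y : erel (EVec _ (X + Y)) (EAdd (EVec _ X) (EVec _ Y))
| EVecZ a X : erel (EVec _ (a *: X)) (EMul (EScal _ a) (EVec _ X))
| EVecSq X : erel (EMul (EVec _ X) (EVec _ X)) (EScal _ 0).

Section ExteriorAlgebra.
Variables (A : comNzRingType) (L : lmodType A).

Definition erelb (s t : eterm A L) : bool := `[< erel s t >].

Lemma erelb_refl : reflexive erelb.
Proof. by move=> s; apply/asboolP; exact: ERefl. Qed.
Lemma erelb_sym : symmetric erelb.
Proof. by move=> s t; apply/asboolP/asboolP; exact: ESym. Qed.
Lemma erelb_trans : transitive erelb.
Proof. by move=> t s u /asboolP st /asboolP tu; apply/asboolP; exact: ETrans st tu. Qed.

Canonical erel_equiv := EquivRel erelb erelb_refl erelb_sym erelb_trans.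

Definition extalg := {eq_quot erel_equiv}.
HB.instance Definition _ := Choice.on extalg.

Definition ext_class (t : eterm A L) : extalg := \pi_extalg t.
Definition ext_repr (u : extalg) : eterm A L := repr u.

Lemma ext_reprK u : ext_class (ext_repr u) = u.
Proof. exact: reprK. Qed.

Lemma ext_classP s t : ext_class s = ext_class t <-> erel s t.
Proof. by split=> [/eqmodP/asboolP|?]; [|apply/eqmodP/asboolP]. Qed.

Definition ext_add (u v : extalg) := ext_class (EAdd (ext_repr u) (ext_repr v)).
Definition ext_mul (u v : extalg) := ext_class (EMul (ext_repr u) (ext_repr v)).
Definition ext_scal (a : A) : extalg := ext_class (EScal _ a).

Lemma ext_repr_class t : erel (ext_repr (ext_class t)) t.
Proof. by apply/ext_classP; rewrite ext_reprK. Qed.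

Lemma ext_class_add s t : ext_class (EAdd s t) = ext_add (ext_class s) (ext_class t).
Proof. by apply/ext_classP/ESym/EAddCongr; exact: ext_repr_class. Qed.

Lemma ext_class_mul s t : ext_class (EMul s t) = ext_mul (ext_class s) (ext_class t).
Proof. by apply/ext_classP/ESym/EMulCongr; exact: ext_repr_class. Qed.

Lemma ext_classW (P : extalg -> Prop) : (forall t, P (ext_class t)) -> forall u, P u.
Proof. by move=> H u; rewrite -(ext_reprK u). Qed.

Let ext_lift_law := (ext_class_add, ext_class_mul).

Lemma ext_addA : associative ext_add.
Proof.
elim/ext_classW=> s; elim/ext_classW=> t; elim/ext_classW=> u.
by rewrite -!ext_class_add; exact/ext_classP/EAddA.
Qed.
Lemma ext_addC : commutative ext_add.
Proof.
elim/ext_classW=> s; elim/ext_classW=> t.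
by rewrite -!ext_class_add; exact/ext_classP/EAddC.
Qed.
Lemma ext_add0 : left_id (ext_scal 0) ext_add.
Proof. by elim/ext_classW=> s; rewrite -!ext_class_add; exact/ext_classP/EAdd0. Qed.
Lemma ext_addN : left_inverse (ext_scal 0) (ext_mul (ext_scal (-1))) ext_add.
Proof.
by elim/ext_classW=> s; rewrite -ext_class_mul -ext_class_add; exact/ext_classP/EAddN.
Qed.

HB.instance Definition _ := GRing.isZmodule.Build extalg ext_addA ext_addC ext_add0 ext_addN.

Lemma ext_mulA : associative ext_mul.
Proof.
elim/ext_classW=> s; elim/ext_classW=> t; elim/ext_classW=> u.
by rewrite -!ext_class_mul; exact/ext_classP/EMulA.
Qed.
Lemma ext_scalC a u : ext_mul u (ext_scal a) = ext_mul (ext_scal a) u.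
Proof.
by elim/ext_classW: u => s; rewrite -!ext_class_mul; exact/ext_classP/EScalC.
Qed.
Lemma ext_mul1l : left_id (ext_scal 1) ext_mul.
Proof. by elim/ext_classW=> s; rewrite -!ext_class_mul; exact/ext_classP/EMul1. Qed.
Lemma ext_mul1r : right_id (ext_scal 1) ext_mul.
Proof. by move=> u; rewrite ext_scalC ext_mul1l. Qed.
Lemma ext_mulDl : left_distributive ext_mul +%R.
Proof.
elim/ext_classW=> s; elim/ext_classW=> t; elim/ext_classW=> u.
by rewrite /+%R /= -!ext_lift_law; exact/ext_classP/EMulDl.
Qed.
Lemma ext_mulDr : right_distributive ext_mul +%R.
Proof.
elim/ext_classW=> s; elim/ext_classW=> t; elim/ext_classW=> u.
by rewrite /+%R /= -!ext_lift_law; exact/ext_classP/EMulDr.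
Qed.

Section Eval.
Variables (B : nzRingType) (g : A -> B) (f : L -> B).
Fixpoint ext_eval (t : eterm A L) : B :=
  match t with
  | EScal a => g a
  | EVec X => f X
  | EAdd s t => ext_eval s + ext_eval t
  | EMul s t => ext_eval s * ext_eval t
  end.
End Eval.

Lemma ext_eval_rel (B : algType A) (f : {linear L -> B}) (ff : forall X, f X * f X = 0) s t :
  erel s t -> ext_eval (in_alg B) f s = ext_eval (in_alg B) f t.
Proof.
elim=> {s t} //=.
- by move=> s t u _ -> _ ->.
- by move=> s s' t t' _ -> _ ->.
- by move=> s s' t t' _ -> _ ->.
- by move=> s t u; rewrite addrA.
- by move=> s t; rewrite addrC.
- by move=> s; rewrite scale0r add0r.
- by move=> s; rewrite scale0r scaleN1r mulN1r addNr.
- by move=> s t u; rewrite mulrA.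
- by move=> s; rewrite scale1r mul1r.
- by move=> s t u; rewrite mulrDl.
- by move=> s t u; rewrite mulrDr.
- by move=> a s; rewrite mulr_algr mulr_algl.
- by move=> a b; rewrite scalerDl.
- by move=> a b; rewrite mulr_algl scalerA.
- by move=> X Y; rewrite raddfD.
- by move=> a X; rewrite linearZ mulr_algl.
- by move=> X; rewrite ff scale0r.
Qed.

Lemma ext_scal1_neq0 : ext_scal 1 != ext_scal 0.
Proof.
apply/eqP=> /ext_classP.
have f0 X : ((\0 : L -> A^o) X : A^o) * (\0 : L -> A^o) X = 0 by rewrite mul0r.
by move=> /(ext_eval_rel f0) /=; rewrite scale1r scale0r => /eqP; rewrite oner_eq0.
Qed.

HB.instance Definition _ := GRing.Zmodule_isNzRing.Build extalg
  ext_mulA ext_mul1l ext_mul1r ext_mulDl ext_mulDr ext_scal1_neq0.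

Definition ext_scale (a : A) (u : extalg) : extalg := ext_scal a * u.

Lemma ext_scalD : {morph ext_scal : a b / a + b}.
Proof. by move=> a b; rewrite /+%R /= -ext_class_add; exact/ext_classP/EScalD. Qed.
Lemma ext_scalM : {morph ext_scal : a b / a * b}.
Proof. by move=> a b; rewrite /*%R /= -ext_class_mul; exact/ext_classP/EScalM. Qed.

Lemma ext_scaleA a b u : ext_scale a (ext_scale b u) = ext_scale (a * b) u.
Proof. by rewrite /ext_scale ext_scalM mulrA. Qed.
Lemma ext_scale1 : left_id 1 ext_scale.
Proof. by move=> u; rewrite /ext_scale mul1r. Qed.
Lemma ext_scaleDr : right_distributive ext_scale +%R.
Proof. by move=> a u v; rewrite /ext_scale mulrDr. Qed.
Lemma ext_scaleDl u : {morph ext_scale^~ u : a b / a + b}.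
Proof. by move=> a b; rewrite /ext_scale ext_scalD mulrDl. Qed.

HB.instance Definition _ := GRing.Zmodule_isLmodule.Build A extalg
  ext_scaleA ext_scale1 ext_scaleDr ext_scaleDl.

Lemma ext_scaleAl a (u v : extalg) : a *: (u * v) = (a *: u) * v.
Proof. exact: mulrA. Qed.
HB.instance Definition _ := GRing.Lmodule_isLalgebra.Build A extalg ext_scaleAl.

Lemma ext_scaleAr a (u v : extalg) : a *: (u * v) = u * (a *: v).
Proof.
by rewrite -[_ *: v]/(ext_scal a * v) mulrA -[u * ext_scal a]/(ext_mul _ _) ext_scalC -mulrA.
Qed.
HB.instance Definition _ := GRing.Lalgebra_isAlgebra.Build A extalg ext_scaleAr.

Definition ext_vec (X : L) : extalg := ext_class (EVec _ X).

Lemma ext_vec_is_linear : linear ext_vec.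
Proof.
move=> a X Y; rewrite /ext_vec -[a *: ext_class _]/(ext_mul _ _) -ext_class_mul -[LHS]/(ext_class _) -[RHS]/(ext_add _ _) -ext_class_add.
by apply/ext_classP/(ETrans (EVecD _ _))/EAddCongr; [exact: EVecZ|exact: ERefl].
Qed.
HB.instance Definition _ := GRing.isLinear.Build A L extalg _ ext_vec ext_vec_is_linear.

Lemma ext_vecM X : ext_vec X * ext_vec X = 0.
Proof. by rewrite /*%R /= -ext_class_mul; exact/ext_classP/EVecSq. Qed.

Lemma ext_class_scal a : ext_class (EScal _ a) = a%:A.
Proof. exact/esym/ext_mul1r. Qed.

(* Universal property of the exterior algebra. *)
Definition ext_lift (B : algType A) (f : L -> B) (u : extalg) : B :=
  ext_eval (in_alg B) f (ext_repr u).

Section Lift.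
Variables (B : algType A) (f : {linear L -> B}).
Hypothesis ff : forall X, f X * f X = 0.

Lemma ext_lift_class t : ext_lift f (ext_class t) = ext_eval (in_alg B) f t.
Proof. exact/(ext_eval_rel ff)/ext_repr_class. Qed.

Lemma ext_lift_vec X : ext_lift f (ext_vec X) = f X.
Proof. exact: ext_lift_class. Qed.

Lemma ext_liftD : {morph ext_lift f : u v / u + v}.
Proof.
elim/ext_classW=> s; elim/ext_classW=> t.
by rewrite -[_ + _]/(ext_add _ _) -ext_class_add !ext_lift_class.
Qed.

Lemma ext_liftM : {morph ext_lift f : u v / u * v}.
Proof.
elim/ext_classW=> s; elim/ext_classW=> t.
by rewrite -[_ * _]/(ext_mul _ _) -ext_class_mul !ext_lift_class.
Qed.

Lemma ext_lift_alg a : ext_lift f a%:A = a%:A.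
Proof. by rewrite -ext_class_scal ext_lift_class. Qed.

Lemma ext_liftZ a u : ext_lift f (a *: u) = a *: ext_lift f u.
Proof. by rewrite -mulr_algl ext_liftM ext_lift_alg mulr_algl. Qed.

Lemma ext_lift_unique (h : {lrmorphism extalg -> B}) :
  (forall X, h (ext_vec X) = f X) -> h =1 ext_lift f.
Proof.
move=> hf; elim/ext_classW; elim=> [a|X|s IHs t IHt|s IHs t IHt].
- by rewrite ext_class_scal ext_lift_alg rmorph_alg.
- by rewrite [LHS]hf [RHS]ext_lift_vec.
- by rewrite ext_class_add [RHS]ext_liftD -IHs -IHt; exact: (rmorphD h).
- by rewrite ext_class_mul [RHS]ext_liftM -IHs -IHt; exact: (rmorphM h).
Qed.
End Lift.

Definition ext_wedge (s : seq L) : extalg := \prod_(X <- s) ext_vec X.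

Definition ext_homog (n : nat) : set (extalg) :=
  [set u | exists r : seq (A * n.-tuple L), u = \sum_(p <- r) p.1 *: ext_wedge p.2].

(* Integer-indexed, so that the degree p + q - 1 of a bracket is not truncated. *)
Definition ext_grade (n : int) : set extalg :=
  if n is Posz m then ext_homog m else [set 0].

Lemma ext_homogW (P : extalg -> Prop) : P 0 -> (forall u v, P u -> P v -> P (u + v)) ->
  (forall n u, ext_homog n u -> P u) -> forall u, P u.
Proof.
move=> P0 PD Ph u.
suff [r ->] : exists r : seq (A * seq L), u = \sum_(p <- r) p.1 *: ext_wedge p.2.
  elim: r => [|[a s] r IH]; rewrite ?big_nil ?big_cons //; apply: PD => //=.
  by apply: (Ph (size s)); exists [:: (a, in_tuple s)]; rewrite big_seq1.
elim/ext_classW: u; elim=> [a|X|s [r1 e1] t [r2 e2]|s [r1 e1] t [r2 e2]].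
- by exists [:: (a, [::])]; rewrite ext_class_scal big_seq1 /ext_wedge big_nil.
- by exists [:: (1, [:: X])]; rewrite big_seq1 /ext_wedge big_seq1 scale1r.
- by exists (r1 ++ r2); rewrite ext_class_add big_cat -e1 -e2.
- exists [seq (p.1 * q.1, p.2 ++ q.2) | p <- r1, q <- r2].
  rewrite ext_class_mul -[LHS]/(ext_class s * ext_class t) e1 e2 big_allpairs_dep mulr_suml.
  apply: eq_bigr => p _; rewrite mulr_sumr; apply: eq_bigr => q _ /=.
  by rewrite /ext_wedge big_cat /= -scalerAl -scalerAr scalerA.
Qed.

Lemma ext_wedge_lift (B : algType A) (f : {linear L -> B}) (ff : forall X, f X * f X = 0)
  s : ext_lift f (ext_wedge s) = \prod_(X <- s) f X.
Proof.
elim: s => [|X s IH]; rewrite /ext_wedge ?big_nil ?big_cons.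
  by rewrite -[1]scale1r ext_lift_alg // scale1r.
by rewrite ext_liftM // IH ext_lift_vec.
Qed.

(* Projection onto the component A of degree 0. *)
Definition ext_aug : extalg -> A := @ext_lift A^o (\0 : L -> A^o).

Lemma aug_sq X : (\0 : L -> A^o) X * (\0 : L -> A^o) X = 0 :> A^o.
Proof. exact: mul0r. Qed.
Lemma ext_augD : {morph ext_aug : u v / u + v}.
Proof. exact: (ext_liftD aug_sq). Qed.
Lemma ext_augM : {morph ext_aug : u v / u * v}.
Proof. exact: (ext_liftM aug_sq). Qed.
Lemma ext_aug_alg a : ext_aug a%:A = a.
Proof. by rewrite /ext_aug (ext_lift_alg aug_sq) -[_%:A]/(a * 1) mulr1. Qed.
Lemma ext_augZ a u : ext_aug (a *: u) = a * ext_aug u.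
Proof. by rewrite /ext_aug (ext_liftZ aug_sq). Qed.
Lemma ext_aug0 : ext_aug 0 = 0.
Proof. by rewrite -(scale0r 1) ext_aug_alg. Qed.

Lemma ext_aug_homog n u : ext_homog n.+1 u -> ext_aug u = 0.
Proof.
case=> r ->; elim: r => [|[a [[|X s] //= Hs]] r IH]; rewrite ?big_nil ?big_cons ?ext_aug0 //.
rewrite [ext_aug _]ext_augD [X in _ + X]IH addr0 /= [LHS]ext_augZ.
by rewrite [ext_aug _](ext_wedge_lift aug_sq) big_cons /= -[LHS]/(a * (0 * _)) mul0r mulr0.
Qed.

(* Multiplication by (-1)^n in degree n. *)
Definition ext_parity : extalg -> extalg := ext_lift (\- ext_vec).
Lemma par_sq X : (\- ext_vec) X * (\- ext_vec) X = 0.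
Proof. by rewrite /= mulrNN ext_vecM. Qed.
Lemma ext_parityD : {morph ext_parity : u v / u + v}.
Proof. exact: (ext_liftD par_sq). Qed.
Lemma ext_parityM : {morph ext_parity : u v / u * v}.
Proof. exact: (ext_liftM par_sq). Qed.
Lemma ext_parityZ a u : ext_parity (a *: u) = a *: ext_parity u.
Proof. exact: (ext_liftZ par_sq). Qed.
Lemma ext_parity0 : ext_parity 0 = 0.
Proof. by rewrite -(scale0r 1) ext_parityZ !scale0r. Qed.
Lemma ext_parity1 : ext_parity 1 = 1.
Proof. by rewrite -[1]scale1r /ext_parity (ext_lift_alg par_sq). Qed.

Lemma ext_parity_homog n u : ext_homog n u -> ext_parity u = (-1) ^+ n * u.
Proof.
case=> r ->; elim: r => [|[a s] r IH]; rewrite ?big_nil ?big_cons.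
  by rewrite mulr0 -(scale0r 1) [LHS]ext_parityZ !scale0r.
rewrite [LHS]ext_parityD [X in _ + X]IH mulrDr; congr (_ + _) => /=.
rewrite ext_parityZ [ext_parity _](ext_wedge_lift par_sq) /= -scalerAr; congr (_ *: _).
have -> : (-1) ^+ n = (-1) ^+ size s :> extalg by rewrite size_tuple.
rewrite /ext_wedge; elim: (tval s) => [|X t IHt]; rewrite ?big_nil ?big_cons ?mulr1 //.
by rewrite /= exprS IHt mulN1r !mulNr !mulrA (commr_sign (ext_vec X)).
Qed.

End ExteriorAlgebra.

Section Derivations.
Variables (k : fieldType) (A : comAlgType k).

Record derivation := Derivation {
  der_fun :> A -> A;
  der_linear : linear der_fun;
  der_leibniz : forall a b, der_fun (a * b) = der_fun a * b + a * der_fun b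
}.

HB.instance Definition _ := gen_eqMixin derivation.
HB.instance Definition _ := gen_choiceMixin derivation.

Lemma der_ext (D E : derivation) : D =1 E -> D = E.
Proof.
case: D E => [d dl dm] [e el em] /= /funext de; case: _ / de el em => el em.
by congr Derivation; exact: Prop_irrelevance.
Qed.

Lemma derD (D : derivation) : {morph D : a b / a + b}.
Proof. by move=> a b; rewrite -[a]scale1r der_linear !scale1r. Qed.
Lemma der0 (D : derivation) : D 0 = 0.
Proof. by apply: (addIr (D 0)); rewrite -derD !add0r. Qed.
Lemma derZ (D : derivation) (c : k) a : D (c *: a) = c *: D a.
Proof. by rewrite -[c *: a]addr0 der_linear der0 !addr0. Qed.

Program Definition der_zero := @Derivation (fun=> 0) _ _.
Next Obligation. by move=> c a b /=; rewrite scaler0 addr0. Qed.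
Next Obligation. by move=> a b /=; rewrite mul0r mulr0 addr0. Qed.

Program Definition der_add (D E : derivation) := @Derivation (fun a => D a + E a) _ _.
Next Obligation. by move=> D E c a b /=; rewrite !der_linear scalerDr addrACA. Qed.
Next Obligation. by move=> D E a b /=; rewrite !der_leibniz mulrDl mulrDr addrACA. Qed.

Program Definition der_scale (f : A) (D : derivation) := @Derivation (fun a => f * D a) _ _.
Next Obligation. by move=> f D c a b /=; rewrite der_linear mulrDr scalerAr. Qed.
Next Obligation. by move=> f D a b /=; rewrite der_leibniz mulrDr mulrA mulrCA. Qed.

Lemma der_addA : associative der_add.
Proof. by move=> D E F; apply: der_ext => a /=; rewrite addrA. Qed.
Lemma der_addC : commutative der_add.
Proof. by move=> D E; apply: der_ext => a /=; rewrite addrC. Qed.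
Lemma der_add0 : left_id der_zero der_add.
Proof. by move=> D; apply: der_ext => a /=; rewrite add0r. Qed.
Lemma der_addN : left_inverse der_zero (der_scale (-1)) der_add.
Proof. by move=> D; apply: der_ext => a /=; rewrite mulN1r addNr. Qed.
HB.instance Definition _ := GRing.isZmodule.Build derivation der_addA der_addC der_add0 der_addN.

Lemma der_scaleA f g D : der_scale f (der_scale g D) = der_scale (f * g) D.
Proof. by apply: der_ext => a /=; rewrite mulrA. Qed.
Lemma der_scale1 : left_id 1 der_scale.
Proof. by move=> D; apply: der_ext => a /=; rewrite mul1r. Qed.
Lemma der_scaleDr : right_distributive der_scale +%R.
Proof. by move=> f D E; apply: der_ext => a /=; rewrite mulrDr. Qed.
Lemma der_scaleDl D : {morph der_scale^~ D : f g / f + g}.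
Proof. by move=> f g; apply: der_ext => a /=; rewrite mulrDl. Qed.
HB.instance Definition _ := GRing.Zmodule_isLmodule.Build A derivation
  der_scaleA der_scale1 der_scaleDr der_scaleDl.

Program Definition der_bracket (D E : derivation) :=
  @Derivation (fun a => D (E a) - E (D a)) _ _.
Next Obligation. by move=> D E c a b /=; rewrite !der_linear scalerBr opprD addrACA. Qed.
Next Obligation.
by move=> D E a b /=; rewrite !der_leibniz !derD !der_leibniz; ring.
Qed.

End Derivations.

(* Quotient of a non-commutative algebra by a proper two-sided ideal. *)
Record ideal (k : fieldType) (R : algType k) := Ideal {
  ideal_set :> R -> Prop;
  ideal0 : ideal_set 0;
  idealB : forall x y, ideal_set x -> ideal_set y -> ideal_set (x - y);
  idealMl : forall x y, ideal_set y -> ideal_set (x * y);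
  idealMr : forall x y, ideal_set x -> ideal_set (x * y);
  ideal1 : ~ ideal_set 1
}.

Section QuotientAlgebra.
Variables (k : fieldType) (R : algType k) (I : ideal R).

Definition quot_rel (x y : R) : bool := `[< I (x - y) >].

Lemma idealN x : I x -> I (- x).
Proof. by rewrite -sub0r; apply: idealB; exact: ideal0. Qed.
Lemma idealD x y : I x -> I y -> I (x + y).
Proof. by move=> Ix /idealN Iy; rewrite -[y]opprK; exact: idealB. Qed.

Lemma quot_rel_refl : reflexive quot_rel.
Proof. by move=> x; apply/asboolP; rewrite subrr; exact: ideal0. Qed.
Lemma quot_rel_sym : symmetric quot_rel.
Proof. by move=> x y; apply/asboolP/asboolP => /idealN; rewrite opprB. Qed.
Lemma quot_rel_trans : transitive quot_rel.
Proof.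
move=> y x z /asboolP xy /asboolP yz; apply/asboolP.
by rewrite -(subrK y x) -addrA; exact: idealD.
Qed.

Canonical quot_equiv := EquivRel quot_rel quot_rel_refl quot_rel_sym quot_rel_trans.

Definition quotalg := {eq_quot quot_equiv}.
HB.instance Definition _ := Choice.on quotalg.

Definition quot_class (x : R) : quotalg := \pi_quotalg x.
Definition quot_repr (u : quotalg) : R := repr u.

Lemma quot_reprK u : quot_class (quot_repr u) = u.
Proof. exact: reprK. Qed.
Lemma quot_classP x y : quot_class x = quot_class y <-> I (x - y).
Proof. by split=> [/eqmodP/asboolP|?]; [|apply/eqmodP/asboolP]. Qed.
Lemma quot_classW (P : quotalg -> Prop) : (forall x, P (quot_class x)) -> forall u, P u.
Proof. by move=> H u; rewrite -(quot_reprK u). Qed.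
Lemma quot_repr_class x : I (quot_repr (quot_class x) - x).
Proof. by apply/quot_classP; rewrite quot_reprK. Qed.

Definition quot_add u v := quot_class (quot_repr u + quot_repr v).
Definition quot_opp u := quot_class (- quot_repr u).
Definition quot_mul u v := quot_class (quot_repr u * quot_repr v).
Definition quot_scale c u := quot_class (c *: quot_repr u).

Lemma quot_class_add x y : quot_add (quot_class x) (quot_class y) = quot_class (x + y).
Proof.
apply/quot_classP; rewrite opprD addrACA.
by apply: idealD; exact: quot_repr_class.
Qed.
Lemma quot_class_opp x : quot_opp (quot_class x) = quot_class (- x).
Proof. by apply/quot_classP; rewrite -opprD; exact/idealN/quot_repr_class. Qed.
Lemma quot_class_mul x y : quot_mul (quot_class x) (quot_class y) = quot_class (x * y).
Proof.
apply/quot_classP; set x' := quot_repr _; set y' := quot_repr _.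
rewrite -(subrK (x' * y) (x' * y')) -addrA -mulrBr -mulrBl.
by apply: idealD; [apply: idealMl|apply: idealMr]; exact: quot_repr_class.
Qed.
Lemma quot_class_scale c x : quot_scale c (quot_class x) = quot_class (c *: x).
Proof.
by apply/quot_classP; rewrite -scalerBr -mulr_algl; exact/idealMl/quot_repr_class.
Qed.

Let quotE := (quot_class_add, quot_class_opp, quot_class_mul, quot_class_scale).

Lemma quot_addA : associative quot_add.
Proof. by do 3!elim/quot_classW => ?; rewrite !quotE addrA. Qed.
Lemma quot_addC : commutative quot_add.
Proof. by do 2!elim/quot_classW => ?; rewrite !quotE addrC. Qed.
Lemma quot_add0 : left_id (quot_class 0) quot_add.
Proof. by elim/quot_classW => ?; rewrite !quotE add0r. Qed.
Lemma quot_addN : left_inverse (quot_class 0) quot_opp quot_add.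
Proof. by elim/quot_classW => ?; rewrite !quotE addNr. Qed.
HB.instance Definition _ :=
  GRing.isZmodule.Build quotalg quot_addA quot_addC quot_add0 quot_addN.

Lemma quot_mulA : associative quot_mul.
Proof. by do 3!elim/quot_classW => ?; rewrite !quotE mulrA. Qed.
Lemma quot_mul1l : left_id (quot_class 1) quot_mul.
Proof. by elim/quot_classW => ?; rewrite !quotE mul1r. Qed.
Lemma quot_mul1r : right_id (quot_class 1) quot_mul.
Proof. by elim/quot_classW => ?; rewrite !quotE mulr1. Qed.
Lemma quot_mulDl : left_distributive quot_mul quot_add.
Proof. by do 3!elim/quot_classW => ?; rewrite !quotE mulrDl. Qed.
Lemma quot_mulDr : right_distributive quot_mul quot_add.
Proof. by do 3!elim/quot_classW => ?; rewrite !quotE mulrDr. Qed.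
Lemma quot_class1_neq0 : quot_class 1 != quot_class 0.
Proof. by apply/eqP => /quot_classP; rewrite subr0; exact: ideal1. Qed.
HB.instance Definition _ := GRing.Zmodule_isNzRing.Build quotalg
  quot_mulA quot_mul1l quot_mul1r quot_mulDl quot_mulDr quot_class1_neq0.

Lemma quot_scaleA a b u : quot_scale a (quot_scale b u) = quot_scale (a * b) u.
Proof. by elim/quot_classW: u => ?; rewrite !quotE scalerA. Qed.
Lemma quot_scale1 : left_id 1 quot_scale.
Proof. by elim/quot_classW => ?; rewrite !quotE scale1r. Qed.
Lemma quot_scaleDr : right_distributive quot_scale quot_add.
Proof. by move=> c; do 2!elim/quot_classW => ?; rewrite !quotE scalerDr. Qed.
Lemma quot_scaleDl u a b : quot_scale (a + b) u = quot_add (quot_scale a u) (quot_scale b u).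
Proof. by elim/quot_classW: u => ?; rewrite !quotE scalerDl. Qed.
HB.instance Definition _ := GRing.Zmodule_isLmodule.Build k quotalg
  quot_scaleA quot_scale1 quot_scaleDr quot_scaleDl.

Lemma quot_scaleAl c (u v : quotalg) : c *: (u * v) = c *: u * v.
Proof.
elim/quot_classW: u => x; elim/quot_classW: v => y.
by rewrite /*:%R /*%R /= !quotE scalerAl.
Qed.
HB.instance Definition _ := GRing.Lmodule_isLalgebra.Build k quotalg quot_scaleAl.
Lemma quot_scaleAr c (u v : quotalg) : c *: (u * v) = u * (c *: v).
Proof.
elim/quot_classW: u => x; elim/quot_classW: v => y.
by rewrite /*:%R /*%R /= !quotE scalerAr.
Qed.
HB.instance Definition _ := GRing.Lalgebra_isAlgebra.Build k quotalg quot_scaleAr.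
End QuotientAlgebra.

(* The A-linearity of the anchor is not listed: it is forced by a divergence   *)
(* operator, by computing div (f * g X) in two ways, and likewise by the       *)
(* existence of the Gerstenhaber bracket.                                      *)
Record lieRinehart (k : fieldType) (A : comAlgType k) (L : lmodType A) := LieRinehart {
  lr_bracket : L -> L -> L;
  lr_anchor : L -> derivation A;
  lr_bracket_linear : forall (c : k) X Y Z,
    lr_bracket (c%:A *: X + Y) Z = c%:A *: lr_bracket X Z + lr_bracket Y Z;
  lr_bracketXX : forall X, lr_bracket X X = 0;
  lr_jacobi : forall X Y Z, lr_bracket X (lr_bracket Y Z) +
    lr_bracket Y (lr_bracket Z X) + lr_bracket Z (lr_bracket X Y) = 0;
  lr_anchor_linear : forall (c : k) X Y,
    lr_anchor (c%:A *: X + Y) = c%:A *: lr_anchor X + lr_anchor Y;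
  lr_anchor_bracket : forall X Y,
    lr_anchor (lr_bracket X Y) = der_bracket (lr_anchor X) (lr_anchor Y);
  lr_leibniz : forall (f : A) X Y,
    lr_bracket X (f *: Y) = f *: lr_bracket X Y + lr_anchor X f *: Y
}.

Section DerLieRinehart.
Variables (k : fieldType) (A : comAlgType k).

Program Definition der_lieRinehart : lieRinehart (derivation A) :=
  @LieRinehart k A (derivation A) (@der_bracket k A) id _ _ _ _ _ _.
Next Obligation. by move=> c D E F; apply: der_ext => a /=; rewrite !derD !mulr_algl !derZ; ring. Qed.
Next Obligation. by move=> D; apply: der_ext => a /=; rewrite subrr. Qed.
Next Obligation.
move=> D E F; apply: der_ext => a /=.
have derN (G : derivation A) x : G (- x) = - G x by rewrite -scaleN1r derZ scaleN1r.
by rewrite !derD !derN; ring.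
Qed.
Next Obligation. by []. Qed.
Next Obligation. by []. Qed.
Next Obligation. by move=> f D E; apply: der_ext => a /=; rewrite !der_leibniz; ring. Qed.
End DerLieRinehart.

Section Gerstenhaber.
Variables (k : fieldType) (A : comAlgType k) (L : lmodType A) (LR : lieRinehart L).

Record divergence := Divergence {
  div_fun :> L -> A;
  div_additive : forall X Y, div_fun (X + Y) = div_fun X + div_fun Y;
  div_bracket : forall X Y, div_fun (lr_bracket LR X Y) =
    lr_anchor LR X (div_fun Y) - lr_anchor LR Y (div_fun X);
  div_scale : forall (a : A) X, div_fun (a *: X) = a * div_fun X + lr_anchor LR X a
}.

(* The Gerstenhaber bracket of the exterior algebra, through the properties    *)
(* that determine it.  All of them are linear in the arguments of which no     *)
(* degree is mentioned.                                                        *)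
Record gerstenhaber_bracket := GerstenhaberBracket {
  gb_fun :> extalg L -> extalg L -> extalg L;
  gb_linearl : forall (c : k) u v w,
    gb_fun (c%:A *: u + v) w = c%:A *: gb_fun u w + gb_fun v w;
  gb_linearr : forall (c : k) u v w,
    gb_fun u (c%:A *: v + w) = c%:A *: gb_fun u v + gb_fun u w;
  gb_grade : forall p q u v,
    ext_grade p u -> ext_grade q v -> ext_grade (p + q - 1) (gb_fun u v);
  gb_antisym : forall p q u v, ext_grade p u -> ext_grade q v ->
    gb_fun u v = - (koszul _ ((p - 1) * (q - 1)) * gb_fun v u);
  gb_jacobi : forall p q u v w, ext_grade p u -> ext_grade q v ->
    gb_fun u (gb_fun v w) =
    gb_fun (gb_fun u v) w + koszul _ ((p - 1) * (q - 1)) * gb_fun v (gb_fun u w);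
  gb_leibniz : forall p q u v w, ext_grade p u -> ext_grade q v ->
    gb_fun u (v * w) = gb_fun u v * w + koszul _ ((p - 1) * q) * (v * gb_fun u w);
  gb_vec : forall X Y, gb_fun (ext_vec X) (ext_vec Y) = ext_vec (lr_bracket LR X Y);
  gb_anchor : forall X (f : A), gb_fun (ext_vec X) f%:A = (lr_anchor LR X f)%:A
}.

(* Indices are counted from 0.  The additive group A of degree 0 is not        *)
(* generated by the empty product 1, whence the second clause.                 *)
Record ext_bv_operator (div : divergence) (Delta : extalg L -> extalg L) : Prop := {
  ext_bv_additive : forall u v, Delta (u + v) = Delta u + Delta v;
  ext_bv_scalar : forall f : A, Delta f%:A = 0;
  ext_bv_wedge : forall n (X : 'I_n -> L),
    Delta (\prod_(i < n) ext_vec (X i)) =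
    \sum_(i < n) \sum_(j < n | (i < j)%N) (-1) ^+ (i + j)%N *
      (ext_vec (lr_bracket LR (X i) (X j)) *
       \prod_(l < n | (l != i) && (l != j)) ext_vec (X l)) +
    \sum_(i < n) (-1) ^+ i.+1 * (div (X i) *: \prod_(l < n | l != i) ext_vec (X l))
}.

Variable gb : gerstenhaber_bracket.

(* The class of Delta Pi in degree 1 of the cohomology of gb Pi vanishes. *)
Definition unimodular (Delta : extalg L -> extalg L) (Pi : extalg L) : Prop :=
  exists a : A, Delta Pi = gb Pi a%:A.

Lemma gbDl u v w : gb (u + v) w = gb u w + gb v w.
Proof. by have := gb_linearl gb 1 u v w; rewrite !scale1r. Qed.
Lemma gbDr u v w : gb u (v + w) = gb u v + gb u w.
Proof. by have := gb_linearr gb 1 u v w; rewrite !scale1r. Qed.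
Lemma gb0l w : gb 0 w = 0.
Proof. by apply: (addIr (gb 0 w)); rewrite -gbDl !add0r. Qed.
Lemma gb0r w : gb w 0 = 0.
Proof. by apply: (addIr (gb w 0)); rewrite -gbDr !add0r. Qed.
Lemma gbZl (c : k) u v : gb (c%:A *: u) v = c%:A *: gb u v.
Proof. by rewrite -[_ *: u]addr0 gb_linearl gb0l addr0. Qed.
Lemma gbZr (c : k) u v : gb u (c%:A *: v) = c%:A *: gb u v.
Proof. by rewrite -[_ *: v]addr0 gb_linearr gb0r addr0. Qed.
Lemma gbNl u v : gb (- u) v = - gb u v.
Proof. by rewrite -[- u]scaleN1r -(scaleN1r 1) gbZl scaleN1r !scaleN1r. Qed.
Lemma gbNr u v : gb u (- v) = - gb u v.
Proof. by rewrite -[- v]scaleN1r -(scaleN1r 1) gbZr scaleN1r !scaleN1r. Qed.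
Lemma gb_signl n u v : gb ((-1) ^+ n * u) v = (-1) ^+ n * gb u v.
Proof. by rewrite -signr_odd; case: odd; rewrite /= ?mul1r ?mulN1r ?gbNl. Qed.
Lemma gb_signr n u v : gb u ((-1) ^+ n * v) = (-1) ^+ n * gb u v.
Proof. by rewrite -signr_odd; case: odd; rewrite /= ?mul1r ?mulN1r ?gbNr. Qed.

Variables (Pi : extalg L) (hPi : ext_homog 2 Pi).

Let hPi2 : ext_grade 2 Pi := hPi.

Lemma gb_bivector_homog n u : ext_homog n u -> ext_homog n.+1 (gb Pi u).
Proof.
move=> hu; have := gb_grade gb hPi2 (hu : ext_grade n%:Z u).
by rewrite addrAC -[2 - 1]/(1 : int) -PoszD add1n.
Qed.

Lemma gb_bivectorM u v : gb Pi (u * v) = gb Pi u * v + ext_parity u * gb Pi v.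
Proof.
move: u; apply: ext_homogW => [|u u' IH IH'|n u hu].
- by rewrite mul0r gb0r mul0r add0r ext_parity0 mul0r.
- by rewrite mulrDl !gbDr IH IH' ext_parityD !mulrDl addrACA.
- rewrite (gb_leibniz gb _ hPi2 (hu : ext_grade n%:Z u)) (ext_parity_homog hu) mulrA.
  by rewrite -[2 - 1]/(1 : int) mul1r.
Qed.

Lemma ext_parityN (u : extalg L) : ext_parity (- u) = - ext_parity u.
Proof. by rewrite -scaleN1r ext_parityZ scaleN1r. Qed.

Lemma ext_parityK (u : extalg L) : ext_parity (ext_parity u) = u.
Proof.
move: u; apply: ext_homogW => [|u v IHu IHv|n u hu].
- by rewrite !ext_parity0.
- by rewrite !ext_parityD IHu IHv.
have := ext_parity_homog hu; rewrite -signr_odd => e; rewrite e.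
by case: (odd n) e => e; rewrite ?expr1 ?expr0 ?mulN1r ?mul1r ?ext_parityN e
  ?expr1 ?expr0 ?mulN1r ?mul1r ?opprK.
Qed.

Lemma ext_parity_bivector u : ext_parity (gb Pi u) = - gb Pi (ext_parity u).
Proof.
move: u; apply: ext_homogW => [|u u' IH IH'|n u hu].
- by rewrite gb0r !ext_parity0 gb0r oppr0.
- by rewrite gbDr !ext_parityD gbDr IH IH' opprD.
- rewrite (ext_parity_homog (gb_bivector_homog hu)) (ext_parity_homog hu) gb_signr.
  by rewrite exprS mulN1r mulNr.
Qed.

Lemma gb_bivector_bracket u v :
  gb Pi (gb u v) = gb (gb Pi u) v - gb (ext_parity u) (gb Pi v).
Proof.
move: u; apply: ext_homogW => [|u u' IH IH'|n u hu].
- by rewrite !gb0l !gb0r ext_parity0 !gb0l subr0.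
- by rewrite gbDl !gbDr IH IH' !gbDl ext_parityD gbDl opprD addrACA.
- rewrite (gb_jacobi gb _ hPi2 (hu : ext_grade n%:Z u)) (ext_parity_homog hu) gb_signl.
  by rewrite -[2 - 1]/(1 : int) mul1r koszulD /koszul /= mulrN1 mulNr.
Qed.

(* The argument hPi, unused here, is what makes this predicate a subring. *)
Definition cocycle_pred & ext_homog 2 Pi : {pred extalg L} := fun u => `[< gb Pi u = 0 >].

Lemma cocycle_closed : subring_closed (cocycle_pred hPi).
Proof.
split=> [|u v /asboolP hu /asboolP hv|u v /asboolP hu /asboolP hv]; apply/asboolP.
- apply: (addrI (gb Pi 1)); rewrite addr0 -[in RHS](mulr1 1) gb_bivectorM.
  by rewrite ext_parity1 mul1r mulr1.
- by rewrite gbDr gbNr hu hv subr0.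
- by rewrite gb_bivectorM hu hv mul0r mulr0 addr0.
Qed.
HB.instance Definition _ := GRing.isSubringClosed.Build _ (cocycle_pred hPi) cocycle_closed.

Record cocycle := Cocycle { cocycle_val :> extalg L; _ : cocycle_val \in cocycle_pred hPi }.
HB.instance Definition _ := [isSub for cocycle_val].
HB.instance Definition _ := [Choice of cocycle by <:].
HB.instance Definition _ := [SubChoice_isSubNzRing of cocycle by <:].

Lemma cocycleP (z : cocycle) : gb Pi (val z) = 0.
Proof. by case: z => z /= /asboolP. Qed.

Definition cocycle_scale (c : k) (z : cocycle) : cocycle :=
  @Cocycle (c%:A *: val z) (introT (asboolP _) (etrans (gbZr _ _ _)
    (etrans (congr1 _ (cocycleP z)) (scaler0 _ _)))).

Lemma cocycle_scaleA a b z : cocycle_scale a (cocycle_scale b z) = cocycle_scale (a * b) z.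
Proof. by apply: val_inj; rewrite /= scalerA mulr_algl scalerA. Qed.
Lemma cocycle_scale1 : left_id 1 cocycle_scale.
Proof. by move=> z; apply: val_inj; rewrite /= !scale1r. Qed.
Lemma cocycle_scaleDr : right_distributive cocycle_scale +%R.
Proof. by move=> a y z; apply: val_inj; rewrite /= scalerDr. Qed.
Lemma cocycle_scaleDl z : {morph cocycle_scale^~ z : a b / a + b}.
Proof. by move=> a b; apply: val_inj; rewrite /= !scalerDl. Qed.
HB.instance Definition _ := GRing.Zmodule_isLmodule.Build k cocycle
  cocycle_scaleA cocycle_scale1 cocycle_scaleDr cocycle_scaleDl.

Lemma cocycle_scaleAl c (y z : cocycle) : c *: (y * z) = c *: y * z.
Proof. by apply: val_inj; rewrite /= -scalerAl. Qed.
HB.instance Definition _ := GRing.Lmodule_isLalgebra.Build k cocycle cocycle_scaleAl.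
Lemma cocycle_scaleAr c (y z : cocycle) : c *: (y * z) = y * (c *: z).
Proof. by apply: val_inj; rewrite /= -scalerAr. Qed.
HB.instance Definition _ := GRing.Lalgebra_isAlgebra.Build k cocycle cocycle_scaleAr.

Definition coboundary : set cocycle := [set z | exists u, val z = gb Pi u].

Lemma coboundary0 : coboundary 0.
Proof. by exists 0; rewrite gb0r. Qed.
Lemma coboundaryB y z : coboundary y -> coboundary z -> coboundary (y - z).
Proof. by move=> [u yu] [v zv]; exists (u - v); rewrite gbDr gbNr -yu -zv. Qed.
Lemma coboundaryMl y z : coboundary z -> coboundary (y * z).
Proof.
move=> [u zu]; exists (ext_parity (val y) * u).
rewrite gb_bivectorM ext_parityK -zu.
have -> : gb Pi (ext_parity (val y)) = - ext_parity (gb Pi (val y)).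
  by rewrite ext_parity_bivector opprK.
by rewrite cocycleP ext_parity0 oppr0 mul0r add0r.
Qed.
Lemma coboundaryMr y z : coboundary y -> coboundary (y * z).
Proof.
move=> [u yu]; exists (u * val z).
by rewrite gb_bivectorM cocycleP mulr0 addr0 -yu.
Qed.
Lemma coboundary1 : ~ coboundary 1.
Proof.
move=> [u] /= /(congr1 (@ext_aug A L)); rewrite -[1]scale1r ext_aug_alg.
suff -> : ext_aug (gb Pi u) = 0 by move=> /eqP; rewrite oner_eq0.
move: u; apply: ext_homogW => [|u v|n u /gb_bivector_homog /ext_aug_homog //].
  by rewrite gb0r ext_aug0.
by rewrite gbDr ext_augD => -> ->; rewrite addr0.
Qed.

Definition coboundary_ideal :=
  Ideal coboundary0 coboundaryB coboundaryMl coboundaryMr coboundary1.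

(* When the square of gb Pi is 0, which follows from gb Pi Pi = 0 if 2 is      *)
(* invertible, the coboundaries are exactly the values of gb Pi.               *)
Definition cohomology := quotalg coboundary_ideal.
HB.instance Definition _ := GRing.Algebra.on cohomology.

Definition coh_class (z : cocycle) : cohomology := quot_class coboundary_ideal z.

Definition coh_grade (n : int) : set cohomology :=
  [set x | exists2 z : cocycle, ext_grade n (val z) & coh_class z = x].

Definition cocycle_bracket (y z : cocycle) : cocycle.
Proof.
apply: (@Cocycle (gb (val y) (val z))); apply/asboolP.
by rewrite gb_bivector_bracket !cocycleP gb0l gb0r subrr.
Defined.

Definition coh_bracket (x y : cohomology) : cohomology :=
  coh_class (cocycle_bracket (quot_repr x) (quot_repr y)).

Lemma coh_bracket_class y z :
  coh_bracket (coh_class y) (coh_class z) = coh_class (cocycle_bracket y z).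
Proof.
apply/quot_classP.
have [u yu] : coboundary (quot_repr (coh_class y) - y) := @quot_repr_class _ _ coboundary_ideal y.
have [v zv] : coboundary (quot_repr (coh_class z) - z) := @quot_repr_class _ _ coboundary_ideal z.
move: yu zv; set y' := quot_repr _; set z' := quot_repr _ => yu zv.
exists (gb u (val z') - gb (ext_parity (val y)) v).
have dPy : gb Pi (ext_parity (val y)) = 0.
  by rewrite -[LHS]opprK -ext_parity_bivector cocycleP ext_parity0 oppr0.
rewrite gbDr gbNr !gb_bivector_bracket cocycleP gb0r subr0 dPy gb0l add0r opprK ext_parityK.
rewrite -yu -zv /= gbDl gbNl gbDr gbNr addrA.
by rewrite -[LHS]/(gb (val y') (val z') - gb (val y) (val z)) subrK.
Qed.

End Gerstenhaber.

Arguments coh_grade {k A L LR} gb {Pi} hPi.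
Arguments coh_bracket {k A L LR} gb {Pi} hPi.

Section BVAlgebra.
Variables (k : fieldType) (E : algType k) (G : int -> set E).

Record graded_supercommutative : Prop := {
  grade0 : forall n, G n 0;
  grade_linear : forall n (c : k) u v, G n u -> G n v -> G n (c *: u + v);
  grade_span : forall u, exists (r : seq int) (f : int -> E),
    (forall n, G n (f n)) /\ u = \sum_(n <- r) f n;
  grade_direct : forall (r : seq int) (f : int -> E), uniq r -> (forall n, G n (f n)) ->
    \sum_(n <- r) f n = 0 -> forall n, n \in r -> f n = 0;
  grade1 : G 0 1;
  gradeM : forall p q u v, G p u -> G q v -> G (p + q) (u * v);
  grade_comm : forall p q u v, G p u -> G q v -> u * v = koszul _ (p * q) * (v * u)
}.

Record bv_operator (D : E -> E) : Prop := {
  bv_linear : forall (c : k) u v, D (c *: u + v) = c *: D u + D v;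
  bv_degree : forall n u, G n u -> G (n - 1) (D u);
  bv_square : forall u, D (D u) = 0;
  bv_order2 : forall p q r a b c, G p a -> G q b -> G r c ->
    D (a * b * c) - D (a * b) * c + D a * b * c
    - koszul _ p * (a * D (b * c)) - koszul _ ((p + 1) * q) * (b * D (a * c))
    + koszul _ p * (a * D b * c) + koszul _ (p + q) * (a * b * D c)
    - D 1 * a * b * c = 0
}.

Definition bv_generates (D : E -> E) (br : E -> E -> E) : Prop :=
  forall p q a b, G p a -> G q b ->
    br a b = koszul _ p * D (a * b) - koszul _ p * (D a * b) - a * D b + a * D 1 * b.

(* As D = 0 satisfies the axioms of a BV operator, a graded algebra that       *)
(* already carries a Gerstenhaber bracket br is a BV algebra when its operator *)
(* generates br.                                                               *)
Definition is_bv_algebra (br : E -> E -> E) : Prop :=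
  graded_supercommutative /\ exists D : E -> E, bv_operator D /\ bv_generates D br.

End BVAlgebra.

Section Poisson.
Variables (k : fieldType) (A : comAlgType k).
Variable gb : gerstenhaber_bracket (der_lieRinehart A).
Variables (Pi : extalg (derivation A)) (hPi : ext_homog 2 Pi).

(* The derived bracket; see poisson_bracket_wedge for its sign. *)
Definition poisson_bracket (f g : A) : A := - ext_aug (gb (gb Pi f%:A) g%:A).

Lemma ext_homog_alg (f : A) : ext_homog 0 (f%:A : extalg (derivation A)).
Proof. by exists [:: (f, [tuple])]; rewrite big_seq1 /ext_wedge big_nil. Qed.

Lemma poisson_bracket_linear f : linear (poisson_bracket f).
Proof.
move=> c a b; rewrite /poisson_bracket scalerDl.
have -> : (c *: a)%:A = c%:A *: a%:A :> extalg (derivation A).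
  by rewrite scalerA mulr_algl.
by rewrite gb_linearr ext_augD ext_augZ mulr_algl opprD scalerN.
Qed.

Lemma poisson_bracket_leibniz f a b :
  poisson_bracket f (a * b) = poisson_bracket f a * b + a * poisson_bracket f b.
Proof.
rewrite /poisson_bracket.
have -> : (a * b)%:A = a%:A * b%:A :> extalg (derivation A).
  by rewrite mulr_algl scalerA.
have h1 : ext_grade 1 (gb Pi f%:A) := gb_bivector_homog gb hPi (ext_homog_alg f).
rewrite (gb_leibniz gb _ h1 (ext_homog_alg a : ext_grade 0 _)) subrr mul0r /koszul expr0 mul1r.
by rewrite ext_augD (ext_augM _ b%:A) (ext_augM a%:A) !ext_aug_alg; ring.
Qed.

Definition hamiltonian (f : A) : derivation A :=
  Derivation (poisson_bracket_linear f) (poisson_bracket_leibniz f).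

(* The modular vector field f |-> div {f, -} is Hamiltonian. *)
Definition poisson_unimodular (div : divergence (der_lieRinehart A)) : Prop :=
  exists h : A, forall f : A, div (hamiltonian f) = hamiltonian h f.
End Poisson.

Lemma poisson_bracket_wedge (k : fieldType) (A : comAlgType k)
  (gb : gerstenhaber_bracket (der_lieRinehart A)) (X Y : derivation A) (f g : A) :
  poisson_bracket gb (ext_vec X * ext_vec Y) f g = X f * Y g - Y f * X g.
Proof.
have hv Z : ext_grade 1 (ext_vec Z : extalg (derivation A)).
  by exists [:: (1, [tuple Z])]; rewrite big_seq1 /ext_wedge big_seq1 scale1r.
have ha (a : A) : ext_grade 0 (a%:A : extalg (derivation A)) := ext_homog_alg a.
have sv Z (a : A) : gb a%:A (ext_vec Z) = - (Z a)%:A.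
  by rewrite (gb_antisym gb (ha a) (hv Z)) gb_anchor subrr mulr0 mul1r.
have XY : ext_grade 2 (ext_vec X * ext_vec Y : extalg (derivation A)).
  exists [:: (1, [tuple X; Y])].
  by rewrite big_seq1 /ext_wedge big_cons big_seq1 scale1r.
have E : gb (ext_vec X * ext_vec Y) f%:A = Y f *: ext_vec X - X f *: ext_vec Y.
  rewrite (gb_antisym gb XY (ha f)) (gb_leibniz gb _ (ha f) (hv X)) !sv /koszul /=.
  rewrite !expr1 !mulN1r !opprD !opprK.
  by rewrite mulNr mulrN !opprK mulr_algl mulr_algr addrC.
rewrite /poisson_bracket E gbDl gbNl.
have H (a : A) Z : ext_aug (gb (a *: ext_vec Z) g%:A) = a * Z g.
  have haZ : ext_grade 1 (a *: ext_vec Z : extalg (derivation A)).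
    by exists [:: (a, [tuple Z])]; rewrite big_seq1 /ext_wedge big_seq1.
  rewrite (gb_antisym gb haZ (ha g)) -[a *: ext_vec Z]mulr_algl (gb_leibniz gb _ (ha g) (ha a)).
  rewrite sv.
  have -> : gb g%:A a%:A = 0 by exact: (gb_grade gb (ha g) (ha a)).
  rewrite /koszul /= !expr0 !mul1r mulrN mul0r add0r opprK mulr_algl.
  by rewrite scalerA ext_aug_alg.
by rewrite ext_augD -(scaleN1r (gb _ _)) ext_augZ !H; ring.
Qed.

Section SmoothFunctions.
Variables (R : realType) (n : nat).
Implicit Types (U : set 'rV[R]_n) (f g : 'rV[R]_n -> R).

(* f has continuous iterated partial derivatives up to order m on U, for U open. *)
Fixpoint Cn_on (m : nat) U f : Prop :=
  (forall x, U x -> {for x, continuous f}) /\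
  if m is m'.+1 then
    forall i : 'I_n, (forall x, U x -> derivable f x (delta_mx 0 i)) /\
      Cn_on m' U (fun x => 'D_(delta_mx 0 i) f x)
  else True.

Definition smooth_on U f : Prop := forall m, Cn_on m U f.

Lemma Cn_onW m U f : Cn_on m.+1 U f -> Cn_on m U f.
Proof.
elim: m f => [|m IH] f [cf df]; split=> // i.
by have [d1 d2] := df i; split=> //; exact: IH.
Qed.

Lemma Cn_on_eq m U f g : open U -> (forall x, U x -> f x = g x) ->
  Cn_on m U f -> Cn_on m U g.
Proof.
move=> oU; elim: m f g => [|m IH] f g fg.
all: have nfg x : U x -> \near x, f x = g x.
1,3: by move=> Ux; apply: filterS (open_nbhs_nbhs (conj oU Ux)) => y; exact: fg.
all: case=> cf df; split.
1,3: move=> x Ux; have := cf x Ux; rewrite /prop_for /continuous_at -(fg x Ux).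
1,2: by apply: cvg_trans; apply: near_eq_cvg; [exact: (nbhs_filter x)|exact: nfg].
- by [].
move=> i; have [d1 d2] := df i; split=> [x Ux|].
  by apply: near_eq_derivable (d1 x Ux) => //; exact: nfg.
by apply: IH d2 => x Ux; apply: near_eq_derive; exact: nfg.
Qed.

Lemma Cn_on_cst m U (c : R) : Cn_on m U (fun=> c).
Proof.
elim: m c => [|m IH] c; first by split=> // x _; exact: cst_continuous.
split=> [x _|i]; first exact: cst_continuous.
split=> [x _|]; first exact: derivable_cst.
by under [X in Cn_on _ _ X]eq_fun do rewrite derive_cst; exact: IH.
Qed.

Lemma Cn_onD m U f g : open U -> Cn_on m U f -> Cn_on m U g -> Cn_on m U (f \+ g).
Proof.
move=> oU; elim: m f g => [|m IH] f g [cf df] [cg dg]; split=> //.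
1,2: by move=> x Ux; exact: (continuousD (cf x Ux) (cg x Ux)).
move=> i; have [f1 f2] := df i; have [g1 g2] := dg i; split=> [x Ux|].
  by apply: derivableD; [exact: f1|exact: g1].
apply: Cn_on_eq (IH _ _ f2 g2) => // x Ux /=.
by rewrite -deriveD //; [exact: f1|exact: g1].
Qed.

Lemma Cn_onM m U f g : open U -> Cn_on m U f -> Cn_on m U g -> Cn_on m U (f \* g).
Proof.
move=> oU; elim: m f g => [|m IH] f g sf sg; have [cf df] := sf; have [cg dg] := sg; split=> //.
1,2: by move=> x Ux; exact: (continuousM (cf x Ux) (cg x Ux)).
move=> i; have [f1 f2] := df i; have [g1 g2] := dg i; split=> [x Ux|].
  by apply: derivableM; [exact: f1|exact: g1].
apply: Cn_on_eq (Cn_onD oU (IH _ _ (Cn_onW sf) g2) (IH _ _ (Cn_onW sg) f2)) => // x Ux /=.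
by rewrite [RHS]deriveM //; [exact: f1|exact: g1].
Qed.
End SmoothFunctions.

(* Non-empty smooth manifolds of dimension n, given by an atlas. *)
Record manifold (R : realType) (n : nat) := Manifold {
  mfd_sort :> topologicalType;
  mfd_point : mfd_sort;
  mfd_hausdorff : hausdorff_space mfd_sort;
  mfd_second_countable : @second_countable mfd_sort;
  mfd_index : Type;
  chart_dom : mfd_index -> set mfd_sort;
  chart : mfd_index -> mfd_sort -> 'rV[R]_n;
  chart_inv : mfd_index -> 'rV[R]_n -> mfd_sort;
  chart_dom_open : forall i, open (chart_dom i);
  chart_cover : forall x, exists i, chart_dom i x;
  chart_image_open : forall i, open (chart i @` chart_dom i);
  chartK : forall i x, chart_dom i x -> chart_inv i (chart i x) = x;
  chart_continuous : forall i x, chart_dom i x -> {for x, continuous (chart i)};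
  chart_inv_continuous : forall i y, (chart i @` chart_dom i) y ->
    {for y, continuous (chart_inv i)};
  chart_transition : forall i j (l : 'I_n),
    smooth_on (chart i @` (chart_dom i `&` chart_dom j))
      (fun y => chart j (chart_inv i y) 0 l)
}.

Section SmoothAlgebra.
Variables (R : realType) (n : nat) (M : manifold R n).

(* The algebra C^oo(M); its derivations are the vector fields of M. *)
Record smooth_fun := SmoothFun {
  sf_fun :> M -> R;
  sf_smooth : forall i, smooth_on (chart i @` chart_dom i) (sf_fun \o chart_inv i)
}.

HB.instance Definition _ := gen_eqMixin smooth_fun.
HB.instance Definition _ := gen_choiceMixin smooth_fun.

Lemma sf_ext (f g : smooth_fun) : f =1 g -> f = g.
Proof.
case: f g => [f hf] [g hg] /= /funext fg; case: _ / fg hg => hg.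
by congr SmoothFun; exact: Prop_irrelevance.
Qed.

Definition sf_cst (c : R) : smooth_fun :=
  @SmoothFun (fun=> c) (fun i m => Cn_on_cst m _ c).
Definition sf_add (f g : smooth_fun) : smooth_fun := @SmoothFun (fun x => f x + g x)
  (fun i m => Cn_onD (@chart_image_open _ _ M i) (sf_smooth f i m) (sf_smooth g i m)).
Definition sf_mul (f g : smooth_fun) : smooth_fun := @SmoothFun (fun x => f x * g x)
  (fun i m => Cn_onM (@chart_image_open _ _ M i) (sf_smooth f i m) (sf_smooth g i m)).

Lemma sf_addA : associative sf_add.
Proof. by move=> f g h; apply: sf_ext => x /=; rewrite addrA. Qed.
Lemma sf_addC : commutative sf_add.
Proof. by move=> f g; apply: sf_ext => x /=; rewrite addrC. Qed.
Lemma sf_add0 : left_id (sf_cst 0) sf_add.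
Proof. by move=> f; apply: sf_ext => x /=; rewrite add0r. Qed.
Lemma sf_addN : left_inverse (sf_cst 0) (sf_mul (sf_cst (-1))) sf_add.
Proof. by move=> f; apply: sf_ext => x /=; rewrite mulN1r addNr. Qed.
HB.instance Definition _ := GRing.isZmodule.Build smooth_fun sf_addA sf_addC sf_add0 sf_addN.

Lemma sf_mulA : associative sf_mul.
Proof. by move=> f g h; apply: sf_ext => x /=; rewrite mulrA. Qed.
Lemma sf_mulC : commutative sf_mul.
Proof. by move=> f g; apply: sf_ext => x /=; rewrite mulrC. Qed.
Lemma sf_mul1 : left_id (sf_cst 1) sf_mul.
Proof. by move=> f; apply: sf_ext => x /=; rewrite mul1r. Qed.
Lemma sf_mulDl : left_distributive sf_mul sf_add.
Proof. by move=> f g h; apply: sf_ext => x /=; rewrite mulrDl. Qed.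
Lemma sf_1_neq0 : sf_cst 1 != sf_cst 0.
Proof.
apply/eqP => /(congr1 (fun f : smooth_fun => f (mfd_point M))) /= /eqP.
by rewrite oner_eq0.
Qed.
HB.instance Definition _ := GRing.Zmodule_isComNzRing.Build smooth_fun
  sf_mulA sf_mulC sf_mul1 sf_mulDl sf_1_neq0.

Definition sf_scale (c : R) (f : smooth_fun) := sf_mul (sf_cst c) f.
Lemma sf_scaleA a b f : sf_scale a (sf_scale b f) = sf_scale (a * b) f.
Proof. by apply: sf_ext => x /=; rewrite mulrA. Qed.
Lemma sf_scale1 : left_id 1 sf_scale.
Proof. exact: sf_mul1. Qed.
Lemma sf_scaleDr : right_distributive sf_scale +%R.
Proof. by move=> c f g; apply: sf_ext => x /=; rewrite mulrDr. Qed.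
Lemma sf_scaleDl f : {morph sf_scale^~ f : a b / a + b}.
Proof. by move=> a b; apply: sf_ext => x /=; rewrite mulrDl. Qed.
HB.instance Definition _ := GRing.Zmodule_isLmodule.Build R smooth_fun
  sf_scaleA sf_scale1 sf_scaleDr sf_scaleDl.

Lemma sf_scaleAl c (f g : smooth_fun) : c *: (f * g) = c *: f * g.
Proof. exact: sf_mulA. Qed.
HB.instance Definition _ := GRing.Lmodule_isLalgebra.Build R smooth_fun sf_scaleAl.
HB.instance Definition _ := GRing.Lalgebra_isComAlgebra.Build R smooth_fun.
End SmoothAlgebra.

(* Main.v *)
Require Import Defs.
From HB Require Import structures.
From mathcomp Require Import all_boot all_order all_algebra.
From mathcomp Require Import all_classical all_reals all_analysis.
From mathcomp Require Import ring.

(* On the exterior algebra the BV operator D satisfies, with u' the image of u *)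
(* under the parity automorphism, D (u v) = D u v + u' (D v) + [u', v] and     *)
(* D^2 = 0; hence D [u', v] = [D u', v] - [u, D v].  If D Pi = [Pi, a], then   *)
(* E = D - [a, -] satisfies the same product formula, squares to 0 and         *)
(* anticommutes with [Pi, -], so that it descends to a BV operator on the      *)
(* cohomology.  In the Poisson case, D [Pi, f] = [D Pi, f] identifies D Pi     *)
(* with the modular vector field; if the latter is the Hamiltonian field of h, *)
(* then D Pi = [Pi, -h].                                                       *)

(** The bracket is the failure of an odd square-zero operator D to be a derivation of the product.
    Such a D is built from the bracket and the divergence as [ext_bv]: the defect of D is prescribed
    on formal terms, and [bv_term_rel] shows that it respects the relations of the exterior algebra.
    The carrying facts are [ext_bv_mul] and [ext_bv_square]. The given [Delta] enters through its
    value at [Pi], where it agrees with D by [ext_bv_operatorE].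

    Applying D to its own product formula gives [ext_bv_gb_parity], hence D[Pi,u] + [Pi,Du] =
    [D Pi,u]: the obstruction to passing to cohomology is the bracket with D Pi. If D Pi = [Pi,a],
    the Jacobi identity makes this obstruction the anticommutator of [Pi,-] and [a,-], so E = D -
    [a,-] anticommutes with [Pi,-] ([twisted_bv_gb]). As [a,-] is an odd derivation of square zero
    that anticommutes with D, the operator E still generates the bracket and still squares to zero.
    The second-order identity then expresses that the bracket is a derivation in its first argument
    ([gerstenhaber_order2]).

    The grading of the cohomology is split off by projections onto homogeneous components, which
    [Pi,-] shifts by one ([ext_compS_gb], [coh_grade_supercommutative]). *)

Set Implicit Arguments.
Unset Strict Implicit.
Unset Printing Implicit Defensive.

Import GRing.Theory.
Local Open Scope ring_scope.

(* For equations of abelian groups in a non-commutative ring, out of the reach of ring. *)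
Ltac zmod_cancel c o := first [rewrite c | rewrite (addrCA _ o); zmod_cancel c o].
Ltac zmod :=
  apply: subr0_eq; rewrite ?(opprD, opprK, subr0, add0r, addr0, oppr0); rewrite -[LHS]addr0 -?addrA;
  repeat match goal with
  | |- - ?x + _ = 0 => zmod_cancel (addKr x) x
  | |- ?x + _ = 0 => zmod_cancel (addNKr x) (- x)
  end; try reflexivity.

(** * Koszul signs *)

(** Signs depend on exponents modulo 2 only. The half-difference [l] is supplied at each use, which
    leaves an identity of integers to [ring]. *)
Lemma koszul_even (R : pzRingType) (l m n : int) : m = n + l * 2 -> koszul R m = koszul R n.
Proof.
move=> ->; rewrite koszulD [koszul R (l * 2)]/koszul.
by rewrite abszM -signr_odd oddM andbF mulr1.
Qed.

Lemma koszulM (R S : pzRingType) (f : {rmorphism R -> S}) (n : int) x :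
  f (koszul R n * x) = koszul S n * f x.
Proof. exact: rmorphMsign. Qed.

Lemma koszulK (R : pzRingType) (n : int) (x : R) : koszul R n * (koszul R n * x) = x.
Proof. exact: signrMK. Qed.

Lemma koszulCA (R : pzRingType) (n : int) (x y : R) :
  x * (koszul R n * y) = koszul R n * (x * y).
Proof. by rewrite !mulrA commr_sign. Qed.

(** * Induction, degrees and supercommutativity in the exterior algebra *)

Section ExteriorAlgebra.
Variables (A : comNzRingType) (L : lmodType A).
Implicit Types (u v w : extalg L) (X Y : L) (f g : A).

Lemma ext_classD (s t : eterm A L) : ext_class (EAdd s t) = ext_class s + ext_class t.
Proof. exact: ext_class_add. Qed.

Lemma ext_classM (s t : eterm A L) : ext_class (EMul s t) = ext_class s * ext_class t.
Proof. exact: ext_class_mul. Qed.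

Lemma ext_classX X : ext_class (EVec A X) = ext_vec X.
Proof. by []. Qed.

Lemma ext_homog0 n : ext_homog n (0 : extalg L).
Proof. by exists [::]; rewrite big_nil. Qed.

Lemma ext_homogD n u v : ext_homog n u -> ext_homog n v -> ext_homog n (u + v).
Proof. by move=> [r ->] [s ->]; exists (r ++ s); rewrite big_cat. Qed.

Lemma ext_homogZ n f u : ext_homog n u -> ext_homog n (f *: u).
Proof.
move=> [r ->]; exists [seq (f * p.1, p.2) | p <- r].
by rewrite big_map scaler_sumr; apply: eq_bigr => p _; rewrite scalerA.
Qed.

Lemma ext_homog_scal f : ext_homog 0 (f%:A : extalg L).
Proof. by exists [:: (f, [tuple])]; rewrite big_seq1 /ext_wedge big_nil. Qed.

Lemma ext_homogM m n u v : ext_homog m u -> ext_homog n v -> ext_homog (m + n) (u * v).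
Proof.
move=> [r ->] [s ->].
exists [seq (p.1 * q.1, cat_tuple p.2 q.2) | p <- r, q <- s].
rewrite big_allpairs_dep mulr_suml; apply: eq_bigr => p _.
rewrite mulr_sumr; apply: eq_bigr => q _ /=.
by rewrite /ext_wedge big_cat /= -scalerAl -scalerAr scalerA.
Qed.

Lemma ext_homog_vec X : ext_homog 1 (ext_vec X).
Proof. by exists [:: (1, [tuple X])]; rewrite big_seq1 /ext_wedge big_seq1 scale1r. Qed.

Lemma ext_homog1_vec u : ext_homog 1 u -> exists X, u = ext_vec X.
Proof.
move=> [r ->]; exists (\sum_(p <- r) p.1 *: thead p.2).
rewrite raddf_sum; apply: eq_bigr => -[f [[|X []] // hs]] _ /=.
by rewrite linearZ /= /ext_wedge big_seq1 /thead (tnth_nth X).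
Qed.

Lemma ext_homog_ind (P : nat -> extalg L -> Prop) :
  (forall n, P n 0) -> (forall n u v, P n u -> P n v -> P n (u + v)) ->
  (forall f, P 0 f%:A) ->
  (forall n X w, ext_homog n w -> P n w -> P n.+1 (ext_vec X * w)) ->
  forall n u, ext_homog n u -> P n u.
Proof.
move=> P0 PD PA PX n u [r ->].
elim: r => [|[f s] r IH]; rewrite ?big_nil ?big_cons //; apply: PD => //= {r IH}.
elim: n f s => [|n IH] f s.
  by rewrite tuple0 /ext_wedge big_nil.
(* In positive degree the coefficient is absorbed into the first vector, so that the induction
   hypothesis is needed for coefficient 1 only. *)
rewrite (tuple_eta s) /ext_wedge big_cons scalerAl -linearZ /=.
apply: PX.
  by exists [:: (1, [tuple of behead s])]; rewrite big_seq1 scale1r.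
by have := IH 1 [tuple of behead s]; rewrite scale1r.
Qed.

Lemma ext_ind (P : extalg L -> Prop) : (forall u v, P u -> P v -> P (u + v)) ->
  (forall f, P f%:A) -> (forall X w, P w -> P (ext_vec X * w)) -> forall u, P u.
Proof.
move=> PD PA PX; have P0 : P 0 by rewrite -(scale0r 1).
by apply: ext_homogW => // n u; apply: (ext_homog_ind (P := fun=> P)) => // *; exact: PX.
Qed.

Lemma ext_grade_scal f : ext_grade 0 (f%:A : extalg L).
Proof. exact: ext_homog_scal. Qed.

Lemma ext_grade_vec X : ext_grade 1 (ext_vec X).
Proof. exact: ext_homog_vec. Qed.

Lemma ext_grade0 n : ext_grade n (0 : extalg L).
Proof. by case: n => // n; exact: ext_homog0. Qed.

Lemma ext_gradeD n u v : ext_grade n u -> ext_grade n v -> ext_grade n (u + v).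
Proof. by case: n => [n|n /= -> ->]; [exact: ext_homogD|rewrite addr0]. Qed.

Lemma ext_gradeZ n f u : ext_grade n u -> ext_grade n (f *: u).
Proof. by case: n => [n|n /= ->]; [exact: ext_homogZ|rewrite scaler0]. Qed.

Lemma ext_gradeN n u : ext_grade n u -> ext_grade n (- u).
Proof. by rewrite -scaleN1r; exact: ext_gradeZ. Qed.

Lemma ext_gradeM m n u v : ext_grade m u -> ext_grade n v -> ext_grade (m + n) (u * v).
Proof.
case: m => [m|m /= ->]; last by rewrite mul0r => _; exact: ext_grade0.
case: n => [n|n /= _ ->]; last by rewrite mulr0; exact: ext_grade0.
exact: ext_homogM.
Qed.

Lemma ext_parity_grade n u : ext_grade n u -> ext_parity u = koszul _ n * u.
Proof. by case: n => [n|n /= ->]; [exact: ext_parity_homog|rewrite mulr0 ext_parity0]. Qed.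

Lemma ext_grade_parity n u : ext_grade n u -> ext_grade n (ext_parity u).
Proof.
move=> hu; rewrite (ext_parity_grade hu) /koszul -signr_odd.
by case: odd; rewrite ?expr0 ?expr1 ?mul1r ?mulN1r //; exact: ext_gradeN.
Qed.

Lemma ext_parity_vec X : ext_parity (ext_vec X) = - ext_vec X.
Proof. by rewrite (ext_parity_grade (ext_grade_vec X)) mulN1r. Qed.

Lemma ext_parity_scal f : ext_parity (f%:A : extalg L) = f%:A.
Proof. by rewrite ext_parityZ ext_parity1. Qed.

Lemma ext_vecC X Y : ext_vec X * ext_vec Y = - (ext_vec Y * ext_vec X).
Proof.
apply/eqP; rewrite -addr_eq0; have := ext_vecM (X + Y).
by rewrite raddfD /= mulrDl !mulrDr !ext_vecM add0r addr0 => ->.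
Qed.

Lemma ext_vec_comm X u : ext_vec X * u = ext_parity u * ext_vec X.
Proof.
elim/ext_ind: u => [u v IHu IHv|f|Y w IH].
- by rewrite ext_parityD mulrDr mulrDl IHu IHv.
- by rewrite ext_parity_scal mulr_algl mulr_algr.
- by rewrite mulrA ext_vecC ext_parityM ext_parity_vec !mulNr -!mulrA IH.
Qed.

Lemma ext_supercomm p q u v : ext_grade p u -> ext_grade q v ->
  u * v = koszul _ (p * q) * (v * u).
Proof.
move=> hu; case: q => [q|q /= ->]; last by rewrite mulr0 mul0r mulr0.
apply: (ext_homog_ind (P := fun q v => u * v = koszul _ (p * Posz q) * (v * u))).
- by move=> n; rewrite mulr0 mul0r mulr0.
- by move=> n v1 v2 e1 e2; rewrite mulrDr e1 e2 -mulrDr -mulrDl.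
- by move=> f; rewrite mulr0 /koszul expr0 mul1r mulr_algl mulr_algr.
- move=> n X w _ IH.
  have e : ext_vec X * u = koszul _ p * (u * ext_vec X).
    by rewrite ext_vec_comm (ext_parity_grade hu) mulrA.
  have {}e : u * ext_vec X = koszul _ p * (ext_vec X * u) by rewrite e koszulK.
  by rewrite mulrA e -!mulrA IH koszulCA intS (mulrDr p 1) mulr1 koszulD -!mulrA.
Qed.
End ExteriorAlgebra.

(** * Consequences of the axioms of the Gerstenhaber bracket *)

Section Bracket.
Variables (k : fieldType) (A : comAlgType k) (L : lmodType A) (LR : lieRinehart L).
Variable gb : gerstenhaber_bracket LR.
Implicit Types (u v w : extalg L) (X Y : L) (f g : A).

Lemma gb_scal_scal f g : gb f%:A g%:A = 0.
Proof. by have := gb_grade gb (ext_grade_scal L f) (ext_grade_scal L g). Qed.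

Lemma gb_scal_vec f X : gb f%:A (ext_vec X) = - (lr_anchor LR X f)%:A.
Proof.
rewrite (gb_antisym gb (ext_grade_scal L f) (ext_grade_vec X)) gb_anchor.
by rewrite subrr mulr0 /koszul expr0 mul1r.
Qed.

Lemma gb_scalZ f g v : gb f%:A (g *: v) = g *: gb f%:A v.
Proof.
rewrite -[g *: v]mulr_algl (gb_leibniz gb v (ext_grade_scal L f) (ext_grade_scal L g)).
by rewrite gb_scal_scal mul0r add0r mulr0 /koszul expr0 mul1r mulr_algl.
Qed.

Lemma gb_scal_vecM f X v :
  gb f%:A (ext_vec X * v) = - (lr_anchor LR X f *: v) - ext_vec X * gb f%:A v.
Proof.
rewrite (gb_leibniz gb v (ext_grade_scal L f) (ext_grade_vec X)) gb_scal_vec.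
by rewrite mulr1 /koszul expr1 mulN1r mulNr mulr_algl.
Qed.

Lemma gb_vecZ X f v : gb (ext_vec X) (f *: v) = lr_anchor LR X f *: v + f *: gb (ext_vec X) v.
Proof.
rewrite -[f *: v]mulr_algl (gb_leibniz gb v (ext_grade_vec X) (ext_grade_scal L f)).
by rewrite gb_anchor mulr0 /koszul expr0 mul1r !mulr_algl.
Qed.

Lemma gb_vec_mul X u v : gb (ext_vec X) (u * v) = gb (ext_vec X) u * v + u * gb (ext_vec X) v.
Proof.
elim/ext_homogW: u => [|u u' IHu IHu'|n u hu].
- by rewrite !mul0r gb0r mul0r addr0.
- by rewrite mulrDl !gbDr IHu IHu' !mulrDl addrACA.
- rewrite (gb_leibniz gb v (ext_grade_vec X) (hu : ext_grade n u)).
  by rewrite subrr mul0r /koszul expr0 mul1r.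
Qed.

Lemma gb_vec_vecM X Y v : gb (ext_vec X) (ext_vec Y * v) =
  ext_vec (lr_bracket LR X Y) * v + ext_vec Y * gb (ext_vec X) v.
Proof. by rewrite gb_vec_mul gb_vec. Qed.

(** Antisymmetry moves the product into the second argument, where [gb_leibniz] applies, and then
    moves each factor back; the signs agree modulo 2. *)
Lemma gb_mul_l p q u w v : ext_grade p u -> ext_grade q w ->
  gb (u * w) v = u * gb w v + koszul _ (p * q) * (w * gb u v).
Proof.
move=> hu hw; elim/ext_homogW: v => [|v v' IHv IHv'|n v hv].
- by rewrite !gb0r !mulr0 addr0.
- by rewrite !gbDr IHv IHv' !mulrDr addrACA.
have {}hv : ext_grade n v by [].
rewrite (gb_antisym gb (ext_gradeM hu hw) hv) (gb_leibniz gb w hv hu).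
rewrite (gb_antisym gb hu hv) (gb_antisym gb hw hv).
rewrite !(mulrN, mulNr) !mulrDr opprD addrC; congr (- _ + - _).
  rewrite [u * (koszul _ _ * _)]koszulCA [LHS]mulrA -koszulD; congr (_ * _).
  by apply: (@koszul_even _ ((n%:Z - 1) * p)); ring.
rewrite (ext_supercomm (gb_grade gb hv hu) hw) [w * (koszul _ _ * _)]koszulCA.
rewrite [LHS]mulrA [RHS]mulrA -!koszulD; congr (_ * _).
by apply: (@koszul_even _ (q * (n%:Z - 1))); ring.
Qed.

Lemma gb_scaleM f g v : gb (f * g)%:A v = f *: gb g%:A v + g *: gb f%:A v.
Proof.
have -> : (f * g)%:A = f%:A * g%:A :> extalg L by rewrite mulr_algl scalerA.
rewrite (gb_mul_l v (ext_grade_scal L f) (ext_grade_scal L g)).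
by rewrite mulr0 /koszul expr0 mul1r !mulr_algl.
Qed.

Lemma gb_vecZ_l f X v : gb (ext_vec (f *: X)) v = f *: gb (ext_vec X) v + ext_vec X * gb f%:A v.
Proof.
rewrite linearZ /= -[X in gb X v]mulr_algl (gb_mul_l v (ext_grade_scal L f) (ext_grade_vec X)).
by rewrite mul0r /koszul expr0 mul1r !mulr_algl.
Qed.

Lemma gb_vecM_l X w v :
  gb (ext_vec X * w) v = ext_vec X * gb w v + ext_parity w * gb (ext_vec X) v.
Proof.
elim/ext_homogW: w => [|w w' IHw IHw'|n w hw].
- by rewrite mulr0 gb0l mulr0 ext_parity0 mul0r addr0.
- by rewrite mulrDr !gbDl IHw IHw' mulrDr ext_parityD mulrDl addrACA.
- have {}hw : ext_grade n w by [].
  by rewrite (gb_mul_l v (ext_grade_vec X) hw) (ext_parity_grade hw) mul1r mulrA.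
Qed.

Lemma anchor_cst X (c : k) : lr_anchor LR X c%:A = 0.
Proof.
have D1 : lr_anchor LR X 1 = 0.
  by apply: (addIr (lr_anchor LR X 1)); rewrite add0r -[in RHS](mulr1 1) der_leibniz mul1r mulr1.
by rewrite derZ D1 scaler0.
Qed.

(** Derivations kill the constants of the ground field; this is what makes the BV operator linear
    over [k], though not over [A]. *)
Lemma gb_cst (c : k) u : gb c%:A%:A u = 0.
Proof.
elim/ext_ind: u => [u v IHu IHv|f|X w IH].
- by rewrite gbDr IHu IHv addr0.
- exact: gb_scal_scal.
- by rewrite gb_scal_vecM IH anchor_cst scale0r mulr0 subr0 oppr0.
Qed.

Lemma gb_1 u : gb 1 u = 0.
Proof. by have := gb_cst 1 u; rewrite !scale1r. Qed.

(** The Jacobi identity would only give that twice the left side vanishes; the induction on [u]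
    works in every characteristic. *)
Lemma gb_scal_square f u : gb f%:A (gb f%:A u) = 0.
Proof.
elim/ext_ind: u => [u v IHu IHv|g|X w IH].
- by rewrite !gbDr IHu IHv addr0.
- by rewrite gb_scal_scal gb0r.
- by rewrite gb_scal_vecM gbDr !gbNr gb_scalZ gb_scal_vecM IH mulr0; zmod.
Qed.

(** * The defect of the BV operator on formal terms *)

Section Laplacian.
Variable div : divergence LR.

(* With D the operator to be built, D (t v) = parity t * D v + bv_term t v. *)
Fixpoint bv_term (t : eterm A L) (v : extalg L) : extalg L :=
  match t with
  | EScal f => gb f%:A v
  | EVec X => - gb (ext_vec X) v - div X *: v
  | EAdd s t => bv_term s v + bv_term t v
  | EMul s t => ext_parity (ext_class s) * bv_term t v + bv_term s (ext_class t * v)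
  end.

Lemma bv_termD t : {morph bv_term t : u v / u + v}.
Proof.
elim: t => [f|X|s IHs t IHt|s IHs t IHt] u v /=.
- by rewrite gbDr.
- by rewrite gbDr opprD scalerDr opprD addrACA.
- by rewrite IHs IHt addrACA.
- by rewrite IHt !mulrDr IHs addrACA.
Qed.

(** The two sides are the values of [bv_term] at [EMul t (EScal f)] and [EMul (EScal f) t]: this is
    compatibility with the relation [EScalC], which takes an induction of its own. *)
Lemma bv_term_scal t f v : ext_parity (ext_class t) * gb f%:A v + bv_term t (f *: v) =
  f *: bv_term t v + gb f%:A (ext_class t * v).
Proof.
elim: t v => [g|X|s IHs t IHt|s IHs t IHt] v /=.
- by rewrite ext_class_scal ext_parity_scal !mulr_algl !gb_scalZ addrC.
- rewrite ext_classX ext_parity_vec gb_vecZ gb_scal_vecM.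
  by rewrite scalerBr scalerN !scalerA mulrC mulNr; zmod.
- rewrite ext_classD ext_parityD !mulrDl gbDr.
  by rewrite addrACA IHs IHt scalerDr addrACA.
- rewrite ext_classM ext_parityM -!mulrA.
  by rewrite addrA -mulrDr IHt -scalerAr mulrDr -addrA IHs -scalerAr scalerDr addrA.
Qed.

(** Each relation is checked in turn. Those involving vectors reflect the structure on [L]: [EVecD]
    and [EVecZ] hold by the additivity of the divergence and its rule for multiples, [EVecSq] by
    [X,X] = 0. *)
Lemma bv_term_rel s t v : erel s t -> bv_term s v = bv_term t v.
Proof.
move=> st; elim: st v => {s t} //=.
- by move=> s t u _ e1 _ e2 v; rewrite e1.
- by move=> s s' t t' _ e1 _ e2 v; rewrite e1 e2.
- by move=> s s' t t' /ext_classP e1 e1' /ext_classP e2 e2' v; rewrite e1 e2 e1' e2'.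
- by move=> s t u v; rewrite addrA.
- by move=> s t v; rewrite addrC.
- by move=> s v; rewrite scale0r gb0l add0r.
- move=> s v; rewrite ext_class_scal ext_parity_scal mulr_algl !scaleN1r.
  by rewrite gbNl gb_1 subr0 addNr scale0r gb0l.
- move=> s t u v; rewrite !ext_classM.
  by rewrite ext_parityM mulrDr -!mulrA addrA.
- move=> s v; rewrite ext_class_scal ext_parity_scal mulr_algl !scale1r.
  by rewrite gb_1 addr0.
- move=> s t u v; rewrite ext_classD.
  by rewrite ext_parityD mulrDl addrACA.
- move=> s t u v; rewrite ext_classD.
  by rewrite mulrDr mulrDl bv_termD addrACA.
- move=> f s v; rewrite ext_class_scal ext_parity_scal !mulr_algl.
  exact: bv_term_scal.
- by move=> f g v; rewrite scalerDl gbDl.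
- by move=> f g v; rewrite !ext_class_scal ext_parity_scal !mulr_algl gb_scaleM gb_scalZ.
- by move=> X Y v; rewrite raddfD /= gbDl div_additive scalerDl !opprD addrACA.
- move=> f X v; rewrite ext_class_scal ext_parity_scal mulr_algl ext_classX.
  rewrite gb_vecZ_l div_scale gb_scal_vecM scalerBr scalerN scalerDl scalerA.
  by zmod.
- move=> X v; rewrite ext_classX ext_parity_vec gb_vec_vecM.
  rewrite lr_bracketXX raddf0 mul0r add0r mulrBr !mulNr mulrN opprK -scalerAr.
  by rewrite scale0r gb0l; zmod.
Qed.
End Laplacian.
End Bracket.

(** * The BV operator of a divergence *)

Section BVOperator.
Variables (k : fieldType) (A : comAlgType k) (L : lmodType A) (LR : lieRinehart L).
Variables (gb : gerstenhaber_bracket LR) (div : divergence LR).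
Implicit Types (u v w : extalg L) (X Y : L) (f g : A).

(** The defect formula at v = 1, with D 1 = 0; the choice of representative is immaterial by
    [bv_term_rel]. *)
Definition ext_bv u := bv_term gb div (ext_repr u) 1.

Local Notation D := ext_bv.

Lemma ext_bv_class t : D (ext_class t) = bv_term gb div t 1.
Proof. exact/bv_term_rel/ext_repr_class. Qed.

Lemma bv_term_ext_bv t v :
  bv_term gb div t v = D (ext_class t * v) - ext_parity (ext_class t) * D v.
Proof.
elim/ext_classW: v => s; rewrite -[_ * _]/(ext_mul _ _) -ext_class_mul !ext_bv_class /=.
by rewrite addrC addKr mulr1.
Qed.

Lemma ext_bvD u v : D (u + v) = D u + D v.
Proof.
elim/ext_classW: u => s; elim/ext_classW: v => t.
by rewrite -[_ + _ in LHS]/(ext_add _ _) -ext_class_add !ext_bv_class.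
Qed.

Lemma ext_bvZ f u : D (f *: u) = f *: D u + gb f%:A u.
Proof.
have := bv_term_ext_bv (EScal _ f) u; rewrite /= ext_class_scal ext_parity_scal !mulr_algl => ->.
by rewrite addrC subrK.
Qed.

Lemma ext_bv_vecM X u : D (ext_vec X * u) = - gb (ext_vec X) u - div X *: u - ext_vec X * D u.
Proof.
have := bv_term_ext_bv (EVec _ X) u; rewrite /= -[ext_class _]/(ext_vec X) ext_parity_vec => ->.
by rewrite mulNr opprK addrK.
Qed.

Lemma ext_bv0 : D 0 = 0.
Proof. by apply: (addIr (D 0)); rewrite -ext_bvD !add0r. Qed.

Lemma ext_bvN u : D (- u) = - D u.
Proof. by apply: (addIr (D u)); rewrite -ext_bvD !addNr ext_bv0. Qed.

Lemma ext_bv_scal f : D f%:A = 0.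
Proof.
by rewrite -ext_class_scal ext_bv_class /=; have := gb_scal_scal gb f 1; rewrite scale1r.
Qed.

Lemma ext_bv_cst (c : k) u : D (c%:A *: u) = c%:A *: D u.
Proof. by rewrite ext_bvZ gb_cst addr0. Qed.

Lemma ext_bv_mul u v : D (u * v) = D u * v + ext_parity u * D v + gb (ext_parity u) v.
Proof.
elim/ext_ind: u => [u u' IHu IHu'|f|X w IH].
- by rewrite mulrDl !ext_bvD IHu IHu' ext_parityD !mulrDl gbDl; zmod.
- by rewrite ext_bv_scal mul0r add0r ext_parity_scal !mulr_algl ext_bvZ.
- rewrite -mulrA !ext_bv_vecM IH ext_parityM ext_parity_vec mulNr gbNl gb_vecM_l ext_parityK.
  by rewrite gb_vec_mul !mulrDr !mulrBl !mulNr -!scalerAl !mulrA; zmod.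
Qed.

Lemma ext_bv_vec X : D (ext_vec X) = - (div X)%:A.
Proof.
have D1 : D 1 = 0 by rewrite -[1]scale1r ext_bv_scal.
have X1 : gb (ext_vec X) 1 = 0.
  by have := gb_anchor gb X 1; rewrite -[X in lr_anchor _ _ X]scale1r anchor_cst scale1r scale0r.
by rewrite -[ext_vec X]mulr1 ext_bv_vecM D1 X1 mulr0 subr0 oppr0 add0r.
Qed.

Lemma ext_bv_vec2 X Y : D (ext_vec X * ext_vec Y) =
  - ext_vec (lr_bracket LR X Y) - div X *: ext_vec Y + div Y *: ext_vec X.
Proof. by rewrite ext_bv_vecM ext_bv_vec gb_vec mulrN mulr_algr opprK. Qed.

Lemma ext_bv_gb_scal f u : D (gb f%:A u) = - gb f%:A (D u).
Proof.
elim/ext_ind: u => [u v IHu IHv|g|Y w IH].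
- by rewrite gbDr !ext_bvD gbDr IHu IHv opprD.
- by rewrite gb_scal_scal ext_bv_scal gb0r ext_bv0 oppr0.
- rewrite gb_scal_vecM ext_bvD !ext_bvN ext_bvZ ext_bv_vecM IH ext_bv_vecM.
  rewrite !(gbDr, gbNr) gb_scalZ gb_scal_vecM.
  rewrite (gb_jacobi gb w (ext_grade_scal L f) (ext_grade_vec Y)) gb_scal_vec gbNl.
  by rewrite subrr mulr0 /koszul expr0 mul1r mulrN; zmod.
Qed.

(** Here the compatibility of the divergence with brackets, [div_bracket], enters; it is the source
    of D^2 = 0. *)
Lemma ext_bv_gb_vec X u : D (gb (ext_vec X) u) = gb (ext_vec X) (D u) - gb (div X)%:A u.
Proof.
elim/ext_ind: u => [u v IHu IHv|g|Y w IH].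
- by rewrite gbDr !ext_bvD !gbDr IHu IHv; zmod.
- by rewrite gb_anchor gb_scal_scal !ext_bv_scal gb0r subr0.
- rewrite gb_vec_vecM ext_bvD !ext_bv_vecM IH !(gbDr, gbNr) gb_vecZ gb_vec_vecM gb_scal_vecM.
  rewrite (gb_jacobi gb w (ext_grade_vec X) (ext_grade_vec Y)) gb_vec div_bracket scalerBl.
  by rewrite subrr mulr0 /koszul expr0 mul1r mulrBr; zmod.
Qed.

Lemma ext_bv_square u : D (D u) = 0.
Proof.
elim/ext_ind: u => [u v IHu IHv|f|X w IH].
- by rewrite !ext_bvD IHu IHv addr0.
- by rewrite ext_bv_scal ext_bv0.
- rewrite ext_bv_vecM !(ext_bvD, ext_bvN) ext_bv_gb_vec ext_bvZ ext_bv_vecM IH mulr0.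
  by zmod.
Qed.

Lemma ext_bv_homog n u : ext_homog n u -> ext_grade (n%:Z - 1) (D u).
Proof.
apply: (ext_homog_ind (P := fun n u => ext_grade (n%:Z - 1) (D u))) => {n u}.
- by move=> n; rewrite ext_bv0; exact: ext_grade0.
- by move=> n u v hu hv; rewrite ext_bvD; exact: ext_gradeD.
- by move=> f; rewrite ext_bv_scal; exact: ext_grade0.
move=> n X w hw IH; rewrite ext_bv_vecM.
have {}hw : ext_grade n w by [].
have e : n.+1%:Z - 1 = n by rewrite intS addrC addKr.
apply: ext_gradeD; last apply: ext_gradeN.
  apply: ext_gradeD; apply: ext_gradeN; rewrite e; last exact: ext_gradeZ.
  by have := gb_grade gb (ext_grade_vec X) hw; rewrite addrC addKr.
have -> : n.+1%:Z - 1 = 1 + (n%:Z - 1) by rewrite e addrC subrK.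
exact: ext_gradeM (ext_grade_vec X) IH.
Qed.

Lemma ext_bv_parity u : D (ext_parity u) = - ext_parity (D u).
Proof.
elim/ext_homogW: u => [|u v IHu IHv|n u hu].
- by rewrite ext_parity0 ext_bv0 ext_parity0 oppr0.
- by rewrite ext_parityD !ext_bvD IHu IHv ext_parityD opprD.
rewrite (ext_parity_grade (ext_bv_homog hu)) (ext_parity_homog hu) koszulD mulrN1 mulNr opprK.
by rewrite /koszul -signr_odd; case: odd; rewrite ?expr0 ?expr1 ?mul1r // !mulN1r ext_bvN.
Qed.

(** The bracket is written as the defect of D on the product [u * v], and D is applied to it: the
    term D (D (u * v)) drops out and the other two are expanded by [ext_bv_mul]. *)
Lemma ext_bv_gb_parity u v :
  D (gb (ext_parity u) v) = gb (D (ext_parity u)) v - gb u (D v).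
Proof.
have -> : gb (ext_parity u) v = D (u * v) - D u * v - ext_parity u * D v.
  by rewrite ext_bv_mul; zmod.
rewrite !(ext_bvD, ext_bvN) ext_bv_square !ext_bv_mul !ext_bv_square ext_parityK.
by rewrite ext_bv_parity !mulNr gbNl mul0r mulr0; zmod.
Qed.

(** Degree 2 suffices, since unimodularity involves [Delta] only at the bivector. Coefficients are
    absorbed into the first vector, and [ext_bv_wedge] is then used for two factors. *)
Lemma ext_bv_operatorE (Delta : extalg L -> extalg L) u :
  ext_bv_operator div Delta -> ext_homog 2 u -> Delta u = D u.
Proof.
move=> [DD DA DW] [r ->].
elim: r => [|[f s] r IH]; first by have := DA 0; rewrite scale0r !big_nil ext_bv0.
rewrite big_cons DD IH ext_bvD; congr (_ + _) => {r IH} /=.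
case: s => [[|X [|Y []]] // hs]; rewrite /ext_wedge /= !big_cons big_nil mulr1.
rewrite scalerAl -linearZ /= ext_bv_vec2; move: (f *: X) => {f hs}X.
have sum2 (P : pred 'I_2) (F : 'I_2 -> extalg L) :
    \sum_(i < 2 | P i) F i = (if P ord0 then F ord0 else 0) + (if P ord_max then F ord_max else 0).
  rewrite big_mkcond big_ord_recr big_ord1 /=; congr (_ + _).
  by rewrite (_ : widen_ord _ _ = ord0) //; exact: val_inj.
have prod2 (P : pred 'I_2) (F : 'I_2 -> extalg L) :
    \prod_(i < 2 | P i) F i = (if P ord0 then F ord0 else 1) * (if P ord_max then F ord_max else 1).
  rewrite big_mkcond big_ord_recr big_ord1 /=; congr (_ * _).
  by rewrite (_ : widen_ord _ _ = ord0) //; exact: val_inj.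
have := DW 2%N (fun i => if val i == 0%N then X else Y).
rewrite !sum2 /= !prod2 /= => ->.
by rewrite !(expr0, expr1, expr2, mulr1, mul1r, mulN1r, addr0, opprK); zmod.
Qed.

(** Expanding by the product formula leaves brackets with [c], which cancel by the Leibniz rule
    [gb_mul_l] in the first argument. It is stated for any such E, so as to apply to the twisted
    operator. *)
Lemma gerstenhaber_order2 (E : extalg L -> extalg L) p q r a b c :
  (forall u v, E (u * v) = E u * v + ext_parity u * E v + gb (ext_parity u) v) ->
  (forall n u, ext_grade n u -> ext_grade (n - 1) (E u)) ->
  ext_grade p a -> ext_grade q b -> ext_grade r c ->
    E (a * b * c) - E (a * b) * c + E a * b * c
    - koszul _ p * (a * E (b * c)) - koszul _ ((p + 1) * q) * (b * E (a * c))
    + koszul _ p * (a * E b * c) + koszul _ (p + q) * (a * b * E c)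
    - E 1 * a * b * c = 0.
Proof.
move=> EM EG ha hb hc.
(* The product formula at 1 * 1 gives E 1 = E 1 + E 1, as [1,1] = 0. *)
have E1 : E 1 = 0.
  by apply: (addrI (E 1)); have := EM 1 1; rewrite ext_parity1 gb_1 !mul1r mulr1 !addr0 => <-.
have haP := ext_grade_parity ha; have hbP := ext_grade_parity hb.
have h1 x : koszul _ p * (a * x) = ext_parity a * x by rewrite (ext_parity_grade ha) mulrA.
have h2 x : koszul _ (p + q) * (a * b * x) = ext_parity a * ext_parity b * x.
  by rewrite -ext_parityM (ext_parity_grade (ext_gradeM ha hb)) mulrA.
have sgn : koszul (extalg L) ((p + 1) * q) = koszul _ (p * q) * koszul _ q.
  by rewrite -koszulD mulrDl mul1r.
have c1 x : koszul _ ((p + 1) * q) * (b * (E a * x)) = E a * b * x.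
  rewrite (ext_supercomm (EG _ _ ha) hb) -[in RHS]mulrA -mulrA; congr (_ * _).
  by apply: (@koszul_even _ q); ring.
have c2 x : koszul _ ((p + 1) * q) * (b * (ext_parity a * x)) = ext_parity a * ext_parity b * x.
  by rewrite (ext_supercomm haP hbP) (ext_parity_grade hb) sgn -!mulrA.
have c3 : gb (ext_parity a * ext_parity b) c =
    ext_parity a * gb (ext_parity b) c + koszul _ ((p + 1) * q) * (b * gb (ext_parity a) c).
  rewrite (gb_mul_l gb c haP hbP); congr (_ + _).
  by rewrite sgn (ext_parity_grade hb) -!mulrA.
rewrite E1 !mul0r subr0 (EM (a * b)) (EM b) (EM a c) ext_parityM c3.
by rewrite h2 -[a * E b * c]mulrA !h1 !mulrDr c1 c2 !mulrA; zmod.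
Qed.
End BVOperator.

(** * Projections onto homogeneous components *)

Section Components.
Variables (A : comNzRingType) (L : lmodType A).
Implicit Types (u v : extalg L) (f : A).

Local Notation eval := (ext_eval (fun f : A => (f%:A : extalg L)%:P)
  (fun X : L => (ext_vec X)%:P * 'X)).

(** Each vector is multiplied by a central variable that records the degree; its square stays 0
    because the variable commutes with the coefficients. *)
Lemma ext_eval_poly_rel s t : erel s t -> eval s = eval t.
Proof.
elim=> {s t} //=.
- by move=> s t u _ -> _ ->.
- by move=> s s' t t' _ -> _ ->.
- by move=> s s' t t' _ -> _ ->.
- by move=> s t u; rewrite addrA.
- by move=> s t; rewrite addrC.
- by move=> s; rewrite scale0r add0r.
- by move=> s; rewrite scale0r scaleN1r polyCN mulN1r addNr.
- by move=> s t u; rewrite mulrA.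
- by move=> s; rewrite scale1r mul1r.
- by move=> s t u; rewrite mulrDl.
- by move=> s t u; rewrite mulrDr.
- by move=> f s; apply/polyP => i; rewrite coefMC coefCM mulr_algl mulr_algr.
- by move=> f g; rewrite scalerDl polyCD.
- by move=> f g; rewrite -polyCM mulr_algl scalerA.
- by move=> X Y; rewrite raddfD /= polyCD mulrDl.
- by move=> f X; rewrite linearZ /= -[f *: ext_vec X]mulr_algl polyCM mulrA.
- move=> X; rewrite mulrA -[_ * 'X * _]mulrA -(commr_polyX (ext_vec X)%:P) mulrA -polyCM ext_vecM.
  by rewrite scale0r !mul0r.
Qed.

Definition ext_comp n u := (eval (ext_repr u))`_n.

Lemma ext_evalE t : eval (ext_repr (ext_class t)) = eval t.
Proof. exact/ext_eval_poly_rel/ext_repr_class. Qed.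

Lemma ext_compD n : {morph ext_comp n : u v / u + v}.
Proof.
elim/ext_classW=> s; elim/ext_classW=> t.
by rewrite -ext_classD /ext_comp !ext_evalE /= coefD.
Qed.

Lemma ext_comp_homog n u : ext_homog n u -> forall m, ext_comp m u = if m == n then u else 0.
Proof.
move=> hu m; rewrite /ext_comp.
(* A homogeneous element of degree n becomes a monomial of degree n with itself as coefficient. *)
suff -> : eval (ext_repr u) = u%:P * 'X^n.
  by rewrite coefCM coefXn; case: eqP; rewrite ?mulr1 ?mulr0.
move: n u hu; apply: ext_homog_ind => [n|n u v eu ev|f|n X w _ IH].
- by have := ext_evalE (EScal L 0); rewrite /= ext_class_scal scale0r mul0r.
- rewrite polyCD mulrDl -eu -ev -{1}(ext_reprK u) -{1}(ext_reprK v) -ext_classD.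
  by rewrite ext_evalE.
- by rewrite mulr1 -ext_class_scal ext_evalE /= ext_class_scal.
- rewrite -{1}(ext_reprK w) -ext_classX -ext_classM ext_evalE /= IH ext_classX.
  by rewrite -mulrA [in LHS](mulrA 'X) -(commr_polyX w%:P) polyCM exprS !mulrA.
Qed.

Lemma ext_homog_comp n u : ext_homog n (ext_comp n u).
Proof.
elim/ext_homogW: u => [|u v hu hv|m u hu].
- by rewrite (ext_comp_homog (ext_homog0 L 0)); case: ifP => _; exact: ext_homog0.
- by rewrite ext_compD; exact: ext_homogD.
- by rewrite (ext_comp_homog hu); case: eqP => [->|_]; [|exact: ext_homog0].
Qed.

Lemma ext_comp0 n : ext_comp n (0 : extalg L) = 0.
Proof. by rewrite (ext_comp_homog (ext_homog0 L 0)) if_same. Qed.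

Lemma ext_comp_sum u : exists N, u = \sum_(0 <= i < N) ext_comp i u.
Proof.
(* Asking for every larger bound lets the bounds of two summands be merged. *)
suff [N H] : exists N, forall M, (N <= M)%N -> u = \sum_(0 <= i < M) ext_comp i u.
  by exists N; exact: H.
elim/ext_homogW: u => [|u v [N1 H1] [N2 H2]|m u hu].
- by exists 0%N => M _; rewrite big1 // => i _; exact: ext_comp0.
- exists (maxn N1 N2) => M; rewrite geq_max => /andP[/H1 e1 /H2 e2].
  by rewrite {1}e1 {1}e2 -big_split; apply: eq_bigr => i _; rewrite ext_compD.
- exists m.+1 => M mM; rewrite big_mkord (bigD1 (Ordinal mM)) //= (ext_comp_homog hu) eqxx.
  rewrite big1 ?addr0 // => i im; rewrite (ext_comp_homog hu); case: eqP => // e.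
  by case/eqP: im; apply: val_inj.
Qed.
End Components.

(** * The grading of the cohomology *)

Section Cohomology.
Variables (k : fieldType) (A : comAlgType k) (L : lmodType A) (LR : lieRinehart L).
Variables (gb : gerstenhaber_bracket LR) (Pi : extalg L) (hPi : ext_homog 2 Pi).
Implicit Types (u v : extalg L) (z : cocycle gb hPi) (x : cohomology gb hPi).

Lemma ext_compS_gb n u : ext_comp n.+1 (gb Pi u) = gb Pi (ext_comp n u).
Proof.
elim/ext_homogW: u => [|u v hu hv|m u hu].
- by rewrite ext_comp0 !gb0r ext_comp0.
- by rewrite ext_compD !gbDr ext_compD hu hv.
- rewrite (ext_comp_homog hu) (ext_comp_homog (gb_bivector_homog gb hPi hu)) eqSS.
  by case: eqP; rewrite ?gb0r.
Qed.

Lemma ext_comp0_gb u : ext_comp 0 (gb Pi u) = 0.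
Proof.
elim/ext_homogW: u => [|u v hu hv|m u hu].
- by rewrite gb0r ext_comp0.
- by rewrite gbDr ext_compD hu hv addr0.
- by rewrite (ext_comp_homog (gb_bivector_homog gb hPi hu)).
Qed.

Lemma gb_comp n z : gb Pi (ext_comp n (val z)) = 0.
Proof. by rewrite -ext_compS_gb cocycleP ext_comp0. Qed.

Lemma coh_class_is_zmod_morphism : zmod_morphism (@coh_class _ _ _ _ gb _ hPi).
Proof. by move=> y z; rewrite /coh_class -quot_class_add -quot_class_opp. Qed.
HB.instance Definition _ := GRing.isZmodMorphism.Build _ _ _ coh_class_is_zmod_morphism.

Lemma coh_class_is_monoid_morphism : monoid_morphism (@coh_class _ _ _ _ gb _ hPi).
Proof. by split=> // y z; rewrite /coh_class -quot_class_mul. Qed.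
HB.instance Definition _ := GRing.isMonoidMorphism.Build _ _ _ coh_class_is_monoid_morphism.

Lemma coh_classZ (c : k) z : coh_class (c *: z) = c *: coh_class z.
Proof. by rewrite /coh_class -quot_class_scale. Qed.

Lemma coh_class_eq0 z : coh_class z = 0 <-> coboundary z.
Proof. by rewrite -[X in coboundary X]subr0; exact: quot_classP. Qed.

Lemma coh_grade_class n z : ext_grade n (val z) -> coh_grade gb hPi n (coh_class z).
Proof. by exists z. Qed.

(** As [Pi,-] raises degrees by one, components of cocycles are cocycles and components of
    coboundaries are coboundaries; the product rules are inherited from representatives. *)
Lemma coh_grade_supercommutative : graded_supercommutative (coh_grade gb hPi).
Proof.
split.
- by move=> n; exists 0; [exact: ext_grade0|exact: raddf0].
- move=> n c _ _ [y hy <-] [z hz <-]; exists (c *: y + z).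
    exact: ext_gradeD (ext_gradeZ _ hy) hz.
  by rewrite raddfD /= coh_classZ.
- elim/quot_classW => z; rewrite -[quot_class _ _]/(coh_class z).
  have comp_cocycle n : ext_comp n (val z) \in cocycle_pred gb hPi by apply/asboolP/gb_comp.
  pose zc n : cocycle gb hPi := Cocycle (comp_cocycle n).
  have [N e] := ext_comp_sum (val z).
  exists [seq Posz i | i <- index_iota 0 N].
  exists (fun n => if n is Posz m then coh_class (zc m) else 0); split.
    case=> m; first by apply: coh_grade_class; exact: ext_homog_comp.
    by exists 0; [exact: ext_grade0|exact: raddf0].
  rewrite big_map -raddf_sum; congr coh_class; apply: val_inj.
  by rewrite raddf_sum.
- move=> r f ur hf e n nr.
  (* Homogeneous representatives are chosen in all degrees at once, so that the vanishing sum of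
     classes lifts to a sum of cocycles equal to some [Pi,u]. *)
  have /choice[z zP] m : exists z, ext_grade m (val z) /\ coh_class z = f m.
    by have [z hz ez] := hf m; exists z.
  have [hz <-] := zP n.
  case: n nr hz => [n|n] nr hz; last first.
    by apply/coh_class_eq0; exists 0; rewrite gb0r; exact: hz.
  have /coh_class_eq0[u eu] : coh_class (\sum_(m <- r) z m) = 0.
    by rewrite raddf_sum -[RHS]e; apply: eq_bigr => m _; case: (zP m).
  apply/coh_class_eq0; rewrite raddf_sum /= in eu.
  (* Taking components of degree n kills every other summand, since [r] has no repetitions. *)
  have {eu} : val (z n) = ext_comp n (gb Pi u).
    rewrite -eu (bigD1_seq (Posz n)) //= ext_compD (ext_comp_homog hz) eqxx.
    rewrite (big_morph _ (ext_compD n) (ext_comp0 L n)) big1 ?addr0 // => m mn.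
    have [hm _] := zP m; case: m mn hm => m mn hm; last by rewrite hm ext_comp0.
    by rewrite (ext_comp_homog hm); case: eqP => // e1; rewrite e1 eqxx in mn.
  (* In degree 0 the component of [Pi,u] is zero; in degree n + 1 the component of u of degree n is
     a primitive. *)
  case: n {nr hz} => [|n] ez; first by exists 0; rewrite ez ext_comp0_gb gb0r.
  by exists (ext_comp n u); rewrite ez ext_compS_gb.
- by exists 1; [rewrite -[val _]scale1r; exact: ext_homog_scal|].
- move=> p q _ _ [y hy <-] [z hz <-]; rewrite -rmorphM; apply: coh_grade_class.
  exact: ext_gradeM.
- move=> p q _ _ [y hy <-] [z hz <-]; rewrite -!rmorphM -koszulM; congr coh_class.
  by apply: val_inj; rewrite koszulM /=; exact: ext_supercomm.
Qed.
End Cohomology.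

(** * The twisted operator and the BV structure on cohomology *)

Section CohomologyBV.
Variables (k : fieldType) (A : comAlgType k) (L : lmodType A) (LR : lieRinehart L).
Variables (gb : gerstenhaber_bracket LR) (div : divergence LR).
Variables (Pi : extalg L) (hPi : ext_homog 2 Pi).

Variable a : A.
Definition twisted_bv (u : extalg L) : extalg L := ext_bv gb div u - gb a%:A u.
Local Notation E := twisted_bv.

Lemma twisted_bvD u v : E (u + v) = E u + E v.
Proof. by rewrite /E ext_bvD gbDr; zmod. Qed.

Lemma twisted_bv0 : E 0 = 0.
Proof. by rewrite /E ext_bv0 gb0r subr0. Qed.

Lemma twisted_bvN u : E (- u) = - E u.
Proof. by rewrite /E ext_bvN gbNr opprD. Qed.

Lemma twisted_bvZ (c : k) u : E (c%:A *: u) = c%:A *: E u.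
Proof. by rewrite /E ext_bv_cst gbZr scalerBr. Qed.

Lemma gb_scal_mul u v : gb a%:A (u * v) = gb a%:A u * v + ext_parity u * gb a%:A v.
Proof.
elim/ext_homogW: u => [|u u' IHu IHu'|n u hu].
- by rewrite mul0r gb0r mul0r ext_parity0 mul0r addr0.
- by rewrite mulrDl !gbDr IHu IHu' ext_parityD !mulrDl addrACA.
have {}hu : ext_grade n u by [].
rewrite (gb_leibniz gb v (ext_grade_scal L a) hu) (ext_parity_grade hu) -mulrA.
by congr (_ + _ * _); apply: (@koszul_even _ (- n%:Z)); ring.
Qed.

Lemma twisted_bv_mul u v : E (u * v) = E u * v + ext_parity u * E v + gb (ext_parity u) v.
Proof. by rewrite /E ext_bv_mul gb_scal_mul mulrBl mulrBr; zmod. Qed.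

(** Both D and [a,-] square to zero, and they anticommute by [ext_bv_gb_scal]. *)
Lemma twisted_bv_square u : E (E u) = 0.
Proof.
rewrite /E ext_bvD ext_bvN gbDr gbNr ext_bv_square ext_bv_gb_scal gb_scal_square.
by zmod.
Qed.

Lemma twisted_bv_grade n u : ext_grade n u -> ext_grade (n - 1) (E u).
Proof.
move=> hu; apply: ext_gradeD.
  case: n hu => [n|n hu]; first exact: ext_bv_homog.
  by rewrite (hu : u = 0) ext_bv0; exact: ext_grade0.
by apply: ext_gradeN; have := gb_grade gb (ext_grade_scal L a) hu; rewrite add0r.
Qed.

Lemma twisted_bv1 : E 1 = 0.
Proof. by rewrite -[1]scale1r /E ext_bv_scal gb_scal_scal subr0. Qed.

Lemma twisted_bv_generates p u v : ext_grade p u ->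
  gb u v = koszul _ p * E (u * v) - koszul _ p * (E u * v) - u * E v.
Proof.
move: twisted_bv twisted_bv_mul => F FM hu.
rewrite FM (ext_parity_grade hu) -mulrA !mulrDr koszulK.
have -> : koszul _ p * gb (koszul _ p * u) v = gb u v by rewrite /koszul gb_signl signrMK.
by zmod.
Qed.

Hypothesis unimod : ext_bv gb div Pi = gb Pi a%:A.

(** D[Pi,u] + [Pi,Du] = [[Pi,a],u], and by the Jacobi identity this equals [Pi,[a,u]] + [a,[Pi,u]],
    which the twist subtracts. *)
Lemma twisted_bv_gb u : E (gb Pi u) = - gb Pi (E u).
Proof.
have PiP : ext_parity Pi = Pi by rewrite (ext_parity_homog hPi) expr2 mulrNN !mul1r.
rewrite /E -{1}PiP ext_bv_gb_parity PiP unimod gbDr gbNr.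
have hPi2 : ext_grade 2 Pi := hPi.
rewrite [gb Pi (gb a%:A u)](gb_jacobi gb u hPi2 (ext_grade_scal L a)).
by rewrite [_ * (0 - 1)](_ : _ = -1) // /koszul expr1 mulN1r; zmod.
Qed.

Lemma twisted_bv_cocycle (z : cocycle gb hPi) : E (val z) \in cocycle_pred gb hPi.
Proof. by apply/asboolP; rewrite -[LHS]opprK -twisted_bv_gb cocycleP twisted_bv0 oppr0. Qed.

Definition cocycle_bv (z : cocycle gb hPi) : cocycle gb hPi := Cocycle (twisted_bv_cocycle z).
Definition coh_bv (x : cohomology gb hPi) : cohomology gb hPi :=
  coh_class (cocycle_bv (quot_repr x)).

Lemma coh_bv_class z : coh_bv (coh_class z) = coh_class (cocycle_bv z).
Proof.
apply/quot_classP.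
have [u zu] : coboundary (quot_repr (coh_class z) - z) :=
  quot_repr_class (coboundary_ideal gb hPi) z.
(* If two representatives differ by [Pi,u], their images under E differ by E[Pi,u] = [Pi,-Eu]. *)
by exists (- E u); rewrite gbNr -twisted_bv_gb -zu /= twisted_bvD twisted_bvN.
Qed.

Lemma coh_bv_operator : bv_operator (coh_grade gb hPi) coh_bv.
Proof.
split.
- move=> c; elim/quot_classW => y; elim/quot_classW => z.
  rewrite -![quot_class _ _]/(coh_class _) -coh_classZ -rmorphD !coh_bv_class -coh_classZ -rmorphD.
  by congr coh_class; apply: val_inj; rewrite /= twisted_bvD twisted_bvZ.
- move=> n _ [z hz <-]; rewrite coh_bv_class; apply: coh_grade_class.
  exact: twisted_bv_grade.
- elim/quot_classW => z; rewrite -[quot_class _ _]/(coh_class _) !coh_bv_class.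
  by apply/coh_class_eq0; exists 0; rewrite gb0r /= twisted_bv_square.
- move=> p q r _ _ _ [x hx <-] [y hy <-] [z hz <-].
  move: coh_bv coh_bv_class => D DE; rewrite -(rmorph1 (@coh_class _ _ _ _ gb _ hPi)) /=.
  rewrite -!rmorphM /= !DE -!rmorphM /= -!koszulM -?(rmorphB, rmorphD) /=.
  (* The identity already holds between cochains, so the coboundary is that of 0. *)
  apply/coh_class_eq0; exists 0; rewrite gb0r.
  rewrite -[RHS](gerstenhaber_order2 twisted_bv_mul twisted_bv_grade hx hy hz).
  by rewrite !(rmorphB, rmorphD, koszulM).
Qed.

Lemma coh_bv_generates : bv_generates (coh_grade gb hPi) coh_bv (coh_bracket gb hPi).
Proof.
move=> p q _ _ [y hy <-] [z hz <-]; rewrite coh_bracket_class.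
move: coh_bv coh_bv_class => D DE; rewrite -(rmorph1 (@coh_class _ _ _ _ gb _ hPi)) /=.
rewrite -!rmorphM /= !DE -!rmorphM /= -!koszulM -?(rmorphB, rmorphD) /=.
congr (coh_class _); apply: val_inj; rewrite !(rmorphB, rmorphD, koszulM) /= twisted_bv1.
by rewrite mulr0 mul0r addr0; exact: twisted_bv_generates.
Qed.

Lemma cohomology_bv_algebra : is_bv_algebra (coh_grade gb hPi) (coh_bracket gb hPi).
Proof.
split; first exact: coh_grade_supercommutative.
by exists coh_bv; split; [exact: coh_bv_operator|exact: coh_bv_generates].
Qed.
End CohomologyBV.

(** * The modular vector field of a Poisson structure *)

Section Poisson.
Variables (k : fieldType) (A : comAlgType k) (gb : gerstenhaber_bracket (der_lieRinehart A)).
Variables (div : divergence (der_lieRinehart A)).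
Variables (Pi : extalg (derivation A)) (hPi : ext_homog 2 Pi).

(** [Pi,f] has degree 1, hence is a vector field, determined by its action g |-> [[Pi,f],g]; the
    sign is that of [poisson_bracket]. *)
Lemma gb_bivector_scal f : gb Pi f%:A = - ext_vec (hamiltonian gb hPi f).
Proof.
have [X e] := ext_homog1_vec (gb_bivector_homog gb hPi (ext_homog_scal _ f)).
rewrite e; apply/esym/eqP; rewrite eqr_oppLR; apply/eqP; rewrite -raddfN; congr ext_vec.
apply: der_ext => g; rewrite [LHS]/= /poisson_bracket e gb_anchor ext_aug_alg.
by rewrite -[RHS]/(-1 * X g) mulN1r.
Qed.

Lemma poisson_unimodularP :
  poisson_unimodular gb hPi div -> exists h : A, ext_bv gb div Pi = gb Pi h%:A.
Proof.
move=> [h hh]; exists (- h).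
have [V eV] := ext_homog1_vec (ext_bv_homog gb div hPi : ext_homog 1 _).
have PiP : ext_parity Pi = Pi by rewrite (ext_parity_homog hPi) expr2 mulrNN !mul1r.
rewrite scaleNr gbNr gb_bivector_scal opprK eV; congr ext_vec; apply: der_ext => f.
(* With V the vector field D Pi, this reads D[Pi,f] = [V,f] = V(f), while D[Pi,f] is also the
   divergence of the Hamiltonian field of f. *)
have := ext_bv_gb_parity gb div Pi f%:A; rewrite PiP eV gb_anchor ext_bv_scal gb0r subr0.
rewrite gb_bivector_scal ext_bvN ext_bv_vec opprK hh => /(congr1 (@ext_aug _ _)).
by rewrite !ext_aug_alg => <-.
Qed.
End Poisson.

Theorem theorem3p10 :
  (forall (k : fieldType) (A : comAlgType k) (L : lmodType A) (LR : lieRinehart L)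
     (gb : gerstenhaber_bracket LR) (div : divergence LR)
     (Delta : extalg L -> extalg L) (Pi : extalg L) (hPi : ext_homog 2 Pi),
     ext_bv_operator div Delta -> gb Pi Pi = 0 -> unimodular gb Delta Pi ->
     is_bv_algebra (coh_grade gb hPi) (coh_bracket gb hPi))
  /\ (forall (R : realType) (n : nat) (M : manifold R n)
     (gb : gerstenhaber_bracket (der_lieRinehart (smooth_fun M)))
     (div : divergence (der_lieRinehart (smooth_fun M)))
     (Pi : extalg (derivation (smooth_fun M))) (hPi : ext_homog 2 Pi),
     gb Pi Pi = 0 -> poisson_unimodular gb hPi div ->
     is_bv_algebra (coh_grade gb hPi) (coh_bracket gb hPi)).
Proof.
split=> [k A L LR gb div Delta Pi hPi bvD _ [a ea]|
         R n M gb div Pi hPi _ /poisson_unimodularP[a ea]].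
  apply: (@cohomology_bv_algebra _ _ _ _ gb div _ hPi a).
  by rewrite -(ext_bv_operatorE gb bvD hPi).
exact: cohomology_bv_algebra ea.
Qed.
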